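(* Let $G$ be a finite group, $k$ an algebraically closed field of characteristic zero, $\omega$ a normalized $3$-cocycle on $G$ with values in $k^\times$, and $\mathcal{C}=\operatorname{Rep}(D^\omega(G))$. The assignments $\mathcal{D}\mapsto(K_{\mathcal{D}},H_{\mathcal{D}},B_{\mathcal{D}})$ and $(K,H,B)\mapsto\mathcal{S}(K,H,B)$ are inverses of each other. Thus there is a bijection between the set of fusion subcategories of $\mathcal{C}$ and the set of triples $(K,H,B)$, where $K,H$ are normal subgroups of $G$ that centralize each other and $B:K\times H\to k^\times$ is a $G$-invariant $\omega$-bicharacter.
   Context: A normalized 3-cocycle is a map $\omega:G^3\to k^\times$ with $\omega(g_2,g_3,g_4)\,\omega(g_1,g_2g_3,g_4)\,\omega(g_1,g_2,g_3)=\omega(g_1g_2,g_3,g_4)\,\omega(g_1,g_2,g_3g_4)$ and $\omega(g,e,l)=1$ ($e$ the identity of $G$). For $a,x,y\in G$ put $$\beta_a(x,y)=\frac{\omega(a,x,y)\,\omega(x,y,y^{-1}x^{-1}axy)}{\omega(x,x^{-1}ax,y)},\qquad \gamma_a(x,y)=\frac{\omega(x,y,a)\,\omega(a,a^{-1}xa,a^{-1}ya)}{\omega(x,a,a^{-1}ya)}.$$ $D^\omega(G)$ is the Dijkgraaf--Pasquier--Roche quasi-triangular quasi-Hopf algebra with basis $\{\delta_g\overline{x}\}_{g,x\in G}$, product $(\delta_g\overline{x})(\delta_h\overline{y})=\beta_g(x,y)\,\delta_g\overline{xy}$ if $h=x^{-1}gx$ and $0$ otherwise, coproduct $\Delta(\delta_g\overline{x})=\sum_{hl=g}\gamma_x(h,l)\,\delta_h\overline{x}\otimes\delta_l\overline{x}$,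 associator $\sum\omega(g,h,l)^{-1}\delta_g\overline{e}\otimes\delta_h\overline{e}\otimes\delta_l\overline{e}$, and $R$-matrix $\sum_{g,h}\delta_g\overline{e}\otimes\delta_h\overline{g}$. $\operatorname{Rep}(D^\omega(G))$ (finite-dimensional modules) is a modular category, braided equivalent to the center of $\operatorname{Vec}_G^\omega$. Let $R$ be a set of representatives of the conjugacy classes of $G$. A $\beta_a$-character of $C_G(a)$ is the trace function of a finite-dimensional module over the twisted group algebra $k^{\beta_a}[C_G(a)]$ (basis $\overline{x}$, $\overline{x}\,\overline{y}=\beta_a(x,y)\overline{xy}$); $\deg\chi=\chi(e)$. Isomorphism classes of simple objects are identified with $\Gamma=\{(a,\chi):a\in R,\ \chi\text{ an irreducible }\beta_a\text{-character of }C_G(a)\}$: $(a,\chi)$ is the simple module $M$ with $\delta_a\overline{e}M\ne0$ on which $\operatorname{span}\{\delta_a\overline{x}:x\in C_G(a)\}\cong k^{\beta_a}[C_G(a)]$ acts on $\delta_a\overline{e}M$ with character $\chi$. A fusion subcategory is a full subcategory, closed under isomorphism, that contains the unit object and is closed under finite direct sums, direct summands, tensor products and duals. For a fusion subcategory $\mathcal{D}$ of $\mathcal{C}$: $K_{\mathcal{D}}=\{gag^{-1}:g\in G,\ (a,\chi)\in\mathcal{D}\cap\Gamma\text{ for some }\chi\}$; $H_{\mathcal{D}}=\bigcap_{\chi:(e,\chi)\in\mathcal{D}}\operatorname{Ker}(\chi)$ with $\operatorname{Ker}(\chi)=\{g\in G:\chi(g)=\chi(e)\}$; and $B_{\mathcal{D}}:K_{\mathcal{D}}\times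 H_{\mathcal{D}}\to k^\times$, $$B_{\mathcal{D}}(x^{-1}ax,h)=\frac{\beta_a(x,h)\,\beta_a(xh,x^{-1})}{\beta_a(x,x^{-1})}\,\frac{\chi(xhx^{-1})}{\deg\chi}\qquad((a,\chi)\in\mathcal{D}\cap\Gamma,\ x\in G,\ h\in H_{\mathcal{D}}),$$ which is well defined; $K_{\mathcal D},H_{\mathcal D}$ are normal subgroups centralizing each other and $B_{\mathcal D}$ is a $G$-invariant $\omega$-bicharacter. For normal subgroups $K,H$ of $G$ that centralize each other (commute elementwise), $B:K\times H\to k^\times$ is an $\omega$-bicharacter if $B(x,yz)=\beta_x(y,z)^{-1}B(x,y)B(x,z)$ and $B(wx,y)=\beta_y(w,x)B(w,y)B(x,y)$ for all $w,x\in K$, $y,z\in H$; it is $G$-invariant if $B(x^{-1}kx,h)=\frac{\beta_k(x,h)\beta_k(xh,x^{-1})}{\beta_k(x,x^{-1})}B(k,xhx^{-1})$ for all $x\in G,k\in K,h\in H$. For such $(K,H,B)$, $\mathcal{S}(K,H,B)$ is the full subcategory of $\mathcal{C}$ whose objects are the finite direct sums of simple objects $(a,\chi)\in\Gamma$ with $a\in K\cap R$ and $\chi(h)=B(a,h)\deg\chi$ for all $h\in H$; it is a fusion subcategory of $\mathcal{C}$. *)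

(* Defs.v *)
From HB Require Import structures.
From mathcomp Require Import all_boot all_order all_algebra all_fingroup.
From mathcomp Require Import character.
From mathcomp Require Import boolp.
From mathcomp Require Import ring.
Set Implicit Arguments.
Unset Strict Implicit.
Unset Printing Implicit Defensive.
Import GRing.Theory.
Local Open Scope ring_scope.

Section Cocycle.
Variables (gT : finGroupType) (k : fieldType).

Record cocycle3 := Cocycle3 {
  cocyc :> gT -> gT -> gT -> k;
  cocyc_neq0 : forall g h l, cocyc g h l != 0;
  cocycE : forall g1 g2 g3 g4 : gT,
    cocyc g2 g3 g4 * cocyc g1 (g2 * g3)%g g4 * cocyc g1 g2 g3 =
    cocyc (g1 * g2)%g g3 g4 * cocyc g1 g2 (g3 * g4)%g;
  cocyc_norm : forall g l, cocyc g 1%g l = 1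
}.

Variable w : cocycle3.

(* [a ^ x] is the right conjugate [x^-1 * a * x]. *)
Definition beta (a x y : gT) : k :=
  w a x y * w x y (a ^ (x * y))%g / w x (a ^ x)%g y.

Definition gamma (a x y : gT) : k :=
  w x y a * w a (x ^ a)%g (y ^ a)%g / w x a (y ^ a)%g.

Lemma cocyc1g h l : w 1%g h l = 1.
Proof.
have := cocycE w 1%g 1%g h l.
rewrite !cocyc_norm !mul1g !mulr1 => E.
by apply: (mulIf (cocyc_neq0 w 1%g h l)); rewrite mul1r.
Qed.

Lemma cocycg1 h l : w h l 1%g = 1.
Proof.
have := cocycE w h l 1%g 1%g.
rewrite !cocyc_norm !mulg1 !mul1r => E.
by apply: (mulIf (cocyc_neq0 w h l 1%g)); rewrite mul1r.
Qed.

Lemma beta1g x y : beta 1 x y = 1.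
Proof. by rewrite /beta !conj1g cocyc1g cocycg1 cocyc_norm invr1 !mulr1. Qed.

Lemma beta_neq0 a x y : beta a x y != 0.
Proof. by rewrite /beta !mulf_neq0 ?invr_eq0 ?cocyc_neq0. Qed.

Lemma gamma_neq0 a x y : gamma a x y != 0.
Proof. by rewrite /gamma !mulf_neq0 ?invr_eq0 ?cocyc_neq0. Qed.

Lemma betag1 a x : beta a x 1 = 1.
Proof. by rewrite /beta !cocycg1 cocyc_norm invr1 !mulr1. Qed.

Lemma betag1l a x : beta a 1 x = 1.
Proof. by rewrite /beta conjg1 cocyc_norm !cocyc1g ?mulr1 invr1 ?mulr1. Qed.

Lemma gammag1 x y : gamma 1 x y = 1.
Proof. by rewrite /gamma cocycg1 cocyc1g cocyc_norm invr1 !mulr1. Qed.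

Let solve1 (p q r : k) : q != 0 -> q * p = r -> p = r / q.
Proof. by move=> q0 <-; rewrite mulrC mulKf. Qed.

Ltac nz := rewrite ?mulf_neq0 ?cocyc_neq0 ?beta_neq0 ?gamma_neq0 //.

Lemma beta_cocycle g x y z :
  beta g x y * beta g (x * y) z = beta g x (y * z) * beta (g ^ x) y z.
Proof.
have E1 : w g x (y * z)%g
    = (w x y z * w g (x * y)%g z * w g x y) / w (g * x)%g y z.
  by apply: solve1; [nz | rewrite -cocycE].
have E2 : w (g ^ x)%g y z
    = (w (g * x)%g y z * w x (g ^ x)%g (y * z)%g)
      / (w x (g ^ x * y)%g z * w x (g ^ x)%g y).
  apply: solve1; first by nz.
  by rewrite (conjgC g x) -cocycE; ring.
have conjgCM : (g ^ x * y = y * g ^ (x * y))%g by rewrite conjgM -conjgC.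
have conjgCM' : (z * g ^ (x * y * z) = g ^ (x * y) * z)%g.
  by rewrite conjgM -conjgC.
have E3 : w x y (g ^ (x * y))%g
    = (w (x * y)%g (g ^ (x * y))%g z * w x y (z * g ^ (x * y * z))%g)
      / (w y (g ^ (x * y))%g z * w x (g ^ x * y)%g z).
  apply: solve1; first by nz.
  by rewrite conjgCM conjgCM' cocycE.
have E4 : w (x * y)%g z (g ^ (x * y * z))%g
    = (w y z (g ^ (x * y * z))%g * w x (y * z)%g (g ^ (x * y * z))%g * w x y z)
      / w x y (z * g ^ (x * y * z))%g.
  by apply: solve1; [nz | rewrite mulrC -cocycE].
rewrite /beta -!conjgM !mulgA E1 E2 E3 E4.
by field; rewrite ?cocyc_neq0.
Qed.

Lemma gamma_beta x y h l :
  gamma x h l * gamma y (h ^ x) (l ^ x) * (beta h x y * beta l x y)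
  = beta (h * l) x y * gamma (x * y) h l.
Proof.
have E1 : w h l x
    = (w (h * l)%g x y * w h l (x * y)%g) / (w l x y * w h (l * x)%g y).
  by apply: solve1; [nz | rewrite -cocycE; ring].
have E2 : w h x (l ^ x)%g
    = (w (h * x)%g (l ^ x)%g y * w h x (l ^ x * y)%g) /
      (w x (l ^ x)%g y * w h (l * x)%g y).
  by apply: solve1; [nz | rewrite (conjgC l x) -cocycE; ring].
have E3 : w x (h ^ x)%g (l ^ x)%g
    = (w (h * x)%g (l ^ x)%g y * w x (h ^ x)%g (l ^ x * y)%g) /
      (w (h ^ x)%g (l ^ x)%g y * w x (h ^ x * l ^ x)%g y).
  by apply: solve1; [nz | rewrite (conjgC h x) -cocycE; ring].
have E4 : w h x y
    = (w (h * x)%g y (l ^ (x * y))%g * w h x (l ^ x * y)%g) /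
      (w x y (l ^ (x * y))%g * w h (x * y)%g (l ^ (x * y))%g).
  by apply: solve1; [nz | rewrite conjgM (conjgC (l ^ x)%g y) -cocycE; ring].
have E5 : w x (h ^ x)%g y
    = (w (h * x)%g y (l ^ (x * y))%g * w x (h ^ x)%g (l ^ x * y)%g) /
      (w (h ^ x)%g y (l ^ (x * y))%g * w x (h ^ x * y)%g (l ^ (x * y))%g).
  apply: solve1; first by nz.
  by rewrite (conjgC h x) [(l ^ (x * y))%g]conjgM (conjgC (l ^ x)%g y) -cocycE; ring.
have E6 : w x y (h ^ (x * y))%g
    = (w (x * y)%g (h ^ (x * y))%g (l ^ (x * y))%g
       * w x y (h ^ (x * y) * l ^ (x * y))%g) /
      (w y (h ^ (x * y))%g (l ^ (x * y))%g * w x (h ^ x * y)%g (l ^ (x * y))%g).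
  apply: solve1; first by nz.
  have -> : (h ^ x * y = y * h ^ (x * y))%g by rewrite conjgM -conjgC.
  by rewrite -cocycE; ring.
rewrite /beta /gamma -!conjgM !conjMg E1 E2 E3 E4 E5 E6.
by field; rewrite ?cocyc_neq0.
Qed.

Lemma beta_antipode p x y :
  beta p x y * beta (p ^ (x * y)) y^-1 x^-1 * beta p (x * y) (x * y)^-1
  = beta p x x^-1 * beta (p ^ x) y y^-1.
Proof.
have E1 := beta_cocycle p x y (x * y)^-1.
have E2 := beta_cocycle (p ^ x) y y^-1 x^-1.
rewrite mulgV betag1l mulr1 -conjgM -invMg in E2.
have E3 : (y * (x * y)^-1 = x^-1)%g by rewrite invMg mulKVg.
by rewrite mulrAC E1 E2 E3 mulrA.
Qed.

(* Left modules: matrices act on column vectors, and [dact g x] is the action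
   of the basis element delta_g xbar.  Since the unit of the algebra is
   \sum_g delta_g ebar, these are exactly its unital matrix representations. *)
Record dmod := DMod {
  ddim : nat;
  dact : gT -> gT -> 'M[k]_ddim;
  dactM : forall g x h y,
    dact g x *m dact h y
    = if h == (g ^ x)%g then beta g x y *: dact g (x * y)%g else 0;
  dact1 : \sum_g dact g 1%g = 1%:M
}.

Definition diso (M N : dmod) : Prop :=
  exists f : 'M[k]_(ddim N, ddim M),
    [/\ row_free f, row_full f &
        forall g x, f *m dact M g x = dact N g x *m f].

Fact dzero_actM g x h y :
  (fun _ _ => 0 : 'M[k]_0) g x *m (fun _ _ => 0 : 'M[k]_0) h y
  = if h == (g ^ x)%g then beta g x y *: (0 : 'M[k]_0) else 0.
Proof. by rewrite mulmx0 scaler0 if_same. Qed.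

Fact dzero_act1 : \sum_(g : gT) (0 : 'M[k]_0) = 1%:M.
Proof. by rewrite [RHS]flatmx0 big1. Qed.

Definition dzero : dmod := DMod dzero_actM dzero_act1.

Section DirectSum.
Variables M N : dmod.
Definition dsum_act g x : 'M[k]_(ddim M + ddim N) :=
  block_mx (dact M g x) 0 0 (dact N g x).

Fact dsum_actM g x h y :
  dsum_act g x *m dsum_act h y
  = if h == (g ^ x)%g then beta g x y *: dsum_act g (x * y)%g else 0.
Proof.
rewrite mulmx_block !mul0mx !mulmx0 !addr0 !add0r !dactM /dsum_act.
by case: eqP => _; rewrite ?scale_block_mx ?scaler0 ?block_mx0.
Qed.

Fact dsum_act1 : \sum_g dsum_act g 1%g = 1%:M.
Proof.
rewrite scalar_mx_block -!dact1.
elim/big_rec3: _ => [|g A B C _ ->]; first by rewrite block_mx0.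
by rewrite add_block_mx !addr0.
Qed.

Definition dsum : dmod := DMod dsum_actM dsum_act1.
End DirectSum.

Definition dsums n (F : 'I_n -> dmod) : dmod :=
  \big[dsum/dzero]_(i < n) F i.

Definition dunit_act (g x : gT) : 'M[k]_1 := ((g == 1%g)%:R)%:M.

Fact dunit_actM g x h y :
  dunit_act g x *m dunit_act h y
  = if h == (g ^ x)%g then beta g x y *: dunit_act g (x * y)%g else 0.
Proof.
rewrite /dunit_act -scalar_mxM; have [->|g1] := eqVneq g 1%g.
  rewrite conj1g mul1r beta1g scale1r.
  by case: eqP => _ //; apply/matrixP=> i j; rewrite !mxE mul0rn.
have Z : (0%:M : 'M[k]_1) = 0 by apply/matrixP=> i j; rewrite !mxE mul0rn.
by rewrite mul0r !Z scaler0 if_same.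
Qed.

Fact dunit_act1 : \sum_g dunit_act g 1%g = 1%:M.
Proof.
rewrite (bigD1 1%g) //= big1 ?addr0 /dunit_act ?eqxx // => g /negPf->.
by apply/matrixP=> i j; rewrite !mxE mul0rn.
Qed.

Definition dunit : dmod := DMod dunit_actM dunit_act1.

Lemma tprodDl m1 n1 m2 n2 (A A' : 'M[k]_(m1, n1)) (B : 'M[k]_(m2, n2)) c :
  tprod (c *: A + A') B = c *: tprod A B + tprod A' B.
Proof.
elim: m1 A A' => [|m IH] A A' /=; first by rewrite scaler0 addr0.
rewrite !linearP /= IH scale_col_mx add_col_mx; congr col_mx.
by rewrite -!trowbE linearP.
Qed.

Lemma tprodDr m1 n1 m2 n2 (A : 'M[k]_(m1, n1)) (B B' : 'M[k]_(m2, n2)) c :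
  tprod A (c *: B + B') = c *: tprod A B + tprod A B'.
Proof.
elim: m1 A => [|m IH] A /=; first by rewrite scaler0 addr0.
by rewrite linearP /= IH scale_col_mx add_col_mx.
Qed.

Lemma tprod0l m1 n1 m2 n2 (B : 'M[k]_(m2, n2)) :
  tprod (0 : 'M[k]_(m1, n1)) B = 0.
Proof.
have := tprodDl 0 0 B 1.
by move=> /(_ m1 n1) /eqP; rewrite !scale1r addr0 -subr_eq0 opprD addNKr oppr_eq0 => /eqP.
Qed.

Lemma tprod0r m1 n1 m2 n2 (A : 'M[k]_(m1, n1)) :
  tprod A (0 : 'M[k]_(m2, n2)) = 0.
Proof.
have := tprodDr A 0 0 1.
by move=> /(_ m2 n2) /eqP; rewrite !scale1r addr0 -subr_eq0 opprD addNKr oppr_eq0 => /eqP.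
Qed.

Lemma tprodZ m1 n1 m2 n2 (A : 'M[k]_(m1, n1)) (B : 'M[k]_(m2, n2)) a b :
  tprod (a *: A) (b *: B) = (a * b) *: tprod A B.
Proof.
rewrite -[a *: A]addr0 tprodDl tprod0l addr0.
by rewrite -[b *: B]addr0 tprodDr tprod0r addr0 scalerA.
Qed.

Lemma tprod_suml (I : Type) (s : seq I) m1 n1 m2 n2 (A : I -> 'M[k]_(m1, n1))
    (B : 'M[k]_(m2, n2)) :
  tprod (\sum_(i <- s) A i) B = \sum_(i <- s) tprod (A i) B.
Proof.
elim: s => [|i s IH]; first by rewrite !big_nil tprod0l.
by rewrite !big_cons -[A i]scale1r tprodDl IH !scale1r.
Qed.

Lemma tprod_sumr (I : Type) (s : seq I) m1 n1 m2 n2 (A : 'M[k]_(m1, n1))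
    (B : I -> 'M[k]_(m2, n2)) :
  tprod A (\sum_(i <- s) B i) = \sum_(i <- s) tprod A (B i).
Proof.
elim: s => [|i s IH]; first by rewrite !big_nil tprod0r.
by rewrite !big_cons -[B i]scale1r tprodDr IH !scale1r.
Qed.

Section Tensor.
Variables M N : dmod.

(* The action through the coproduct; [tprod] is the Kronecker product. *)
Definition dtensor_act (g x : gT) : 'M[k]_(ddim M * ddim N) :=
  \sum_(p : gT * gT | (p.1 * p.2)%g == g)
    gamma x p.1 p.2 *: tprod (dact M p.1 x) (dact N p.2 x).

Fact dtensor_actM g x h y :
  dtensor_act g x *m dtensor_act h y
  = if h == (g ^ x)%g then beta g x y *: dtensor_act g (x * y)%g else 0.
Proof.
rewrite mulmx_suml.
have E (p : gT * gT) : (p.1 * p.2)%g == g ->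
    (gamma x p.1 p.2 *: tprod (dact M p.1 x) (dact N p.2 x)) *m dtensor_act h y
    = if h == (g ^ x)%g then beta g x y *:
        (gamma (x * y) p.1 p.2 *:
           tprod (dact M p.1 (x * y)%g) (dact N p.2 (x * y)%g))
      else 0.
  case: p => a b /= /eqP <-.
  rewrite mulmx_sumr big_mkcond (bigD1 (a ^ x, b ^ x)%g) //=.
  rewrite [X in _ + X]big1 ?addr0 => [|[c d] /= ne].
    rewrite -conjMg eq_sym; case: eqP => // _.
    rewrite -scalemxAl -scalemxAr -tprodE !dactM !eqxx tprodZ !scalerA.
    by rewrite -gamma_beta mulrA.
  case: eqP => // _.
  rewrite -scalemxAl -scalemxAr -tprodE !dactM.
  move: ne; rewrite xpair_eqE negb_and => /orP[/negPf->|/negPf->].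
    by rewrite tprod0l !scaler0.
  by rewrite tprod0r !scaler0.
rewrite (eq_bigr _ E); case: eqP => _; last by rewrite big1.
by rewrite scaler_sumr.
Qed.

Fact dtensor_act1 : \sum_g dtensor_act g 1%g = 1%:M.
Proof.
rewrite -tprod1 -!dact1 tprod_suml.
under [RHS]eq_bigr do rewrite tprod_sumr.
rewrite pair_big /=; symmetry; rewrite [RHS](_ : _ = \sum_g \sum_(p : gT * gT | (p.1 * p.2)%g == g)
  tprod (dact M p.1 1%g) (dact N p.2 1%g)); last first.
  by apply: eq_bigr => g _; apply: eq_bigr => p _; rewrite gammag1 scale1r.
by rewrite [LHS](partition_big (fun p : gT * gT => (p.1 * p.2)%g) predT).
Qed.

Definition dtensor : dmod := DMod dtensor_actM dtensor_act1.
End Tensor.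

Section Dual.
Variable M : dmod.

(* The contragredient action through the antipode
     S(delta_g xbar) = beta_{g^-1}(x, x^-1)^-1 gamma_x(g, g^-1)^-1
                         delta_{x^-1 g^-1 x} \overline{x^-1}
   of the quasi-Hopf algebra (whose evaluation element is alpha = 1). *)
Definition ddual_act (g x : gT) : 'M[k]_(ddim M) :=
  (beta g^-1 x x^-1 * gamma x g g^-1)^-1 *: (dact M (g^-1 ^ x)%g x^-1%g)^T.

Fact ddual_actM g x h y :
  ddual_act g x *m ddual_act h y
  = if h == (g ^ x)%g then beta g x y *: ddual_act g (x * y)%g else 0.
Proof.
rewrite /ddual_act -scalemxAl -scalemxAr -trmx_mul dactM -conjgM mulgV conjg1.
rewrite conjVg eqg_inv eq_sym; case: eqP => [->|_]; last by rewrite trmx0 !scaler0.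
rewrite -invMg -!conjVg -conjgM [(_ *: dact _ _ _)^T]linearZ /= !scalerA; congr (_ *: _).
have A := beta_antipode g^-1 x y.
have := gamma_beta x y g g^-1; rewrite mulgV beta1g mul1r => <-.
have -> : beta (g^-1 ^ (x * y)) y^-1 x^-1 =
    beta g^-1 x x^-1 * beta (g^-1 ^ x) y y^-1
    / (beta g^-1 x y * beta g^-1 (x * y) (x * y)^-1).
  apply: solve1; first by rewrite mulf_neq0 ?beta_neq0.
  by rewrite -A; ring.
by field; rewrite ?beta_neq0 ?gamma_neq0.
Qed.

Fact ddual_act1 : \sum_g ddual_act g 1%g = 1%:M.
Proof.
rewrite -trmx1 -(dact1 M) (reindex_inj invg_inj) linear_sum /=.
apply: eq_bigr => g _.
by rewrite /ddual_act gammag1 betag1l invgK conjg1 invg1 mulr1 invr1 scale1r.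
Qed.

Definition ddual : dmod := DMod ddual_actM ddual_act1.
End Dual.

(* Full subcategories closed under isomorphism are predicates on modules.  The
   associator and the R-matrix do not enter the closure conditions. *)
Record fusion_subcat := FusionSubcat {
  fobj :> dmod -> Prop;
  fobj_iso : forall M N, diso M N -> fobj M -> fobj N;
  fobj_unit : fobj dunit;
  fobj_sums : forall n (F : 'I_n -> dmod),
    (forall i, fobj (F i)) -> fobj (dsums F);
  fobj_summand : forall M N, fobj (dsum M N) -> fobj M /\ fobj N;
  fobj_tensor : forall M N, fobj M -> fobj N -> fobj (dtensor M N);
  fobj_dual : forall M, fobj M -> fobj (ddual M)
}.

(* Subspaces of column vectors are given by the row space of their transpose. *)
Definition mx_simple (I : Type) (P : pred I) n (A : I -> 'M[k]_n) : Prop :=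
  (0 < n)%N /\
  forall U : 'M[k]_n,
    (forall i, P i -> stablemx U (A i)^T) -> U = 0 \/ row_full U.

Definition dsimple (M : dmod) : Prop :=
  mx_simple predT (fun p : gT * gT => dact M p.1 p.2).

(* Modules over the twisted group algebra k^{beta_a}[C_G(a)]; the values of
   [tact] outside the centralizer are irrelevant. *)
Record tmod (a : gT) := TMod {
  tdim : nat;
  tact : gT -> 'M[k]_tdim;
  tactM : {in 'C[a]%g &, forall x y,
    tact x *m tact y = beta a x y *: tact (x * y)%g};
  tact1 : tact 1%g = 1%:M
}.

Definition tsimple a (N : tmod a) : Prop :=
  mx_simple (fun x => x \in 'C[a]%g) (tact N).

(* Characters of C_G(a) are extended by 0 to the whole group. *)
Definition tchar a (N : tmod a) : {ffun gT -> k} :=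
  [ffun x => if x \in 'C[a]%g then \tr (tact N x) else 0].

Definition irr_char (a : gT) (chi : {ffun gT -> k}) : Prop :=
  exists2 N : tmod a, tsimple N & chi = tchar N.

(* The columns of [V] form a basis of the subspace delta_a ebar M, on which the
   delta_a xbar with x in C_G(a) act through the matrices of [N]. *)
Definition affords (M : dmod) (a : gT) (chi : {ffun gT -> k}) : Prop :=
  exists (N : tmod a) (V : 'M[k]_(ddim M, tdim N)),
    [/\ row_free V^T, (V^T :=: (dact M a 1%g)^T)%MS,
        {in 'C[a]%g, forall x, dact M a x *m V = V *m tact N x}
      & chi = tchar N].

Definition is_simple_at (M : dmod) (a : gT) (chi : {ffun gT -> k}) : Prop :=
  [/\ dsimple M, dact M a 1%g != 0 & affords M a chi].

(* [R] is the set of representatives of the conjugacy classes. *)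
Definition in_Gamma (R : {set gT}) (a : gT) (chi : {ffun gT -> k}) : Prop :=
  a \in R /\ irr_char a chi.

Definition in_subcat (R : {set gT}) (D : dmod -> Prop) a chi : Prop :=
  in_Gamma R a chi /\ exists2 M, is_simple_at M a chi & D M.

Definition subcat_K (R : {set gT}) (D : dmod -> Prop) : {set gT} :=
  [set y | `[< exists g a chi,
                 in_subcat R D a chi /\ y = (g * a * g^-1)%g >]].

Definition subcat_H (R : {set gT}) (D : dmod -> Prop) : {set gT} :=
  [set h | `[< forall chi, in_subcat R D 1%g chi -> chi h = chi 1%g >]].

Definition is_subcat_B (R : {set gT}) (D : dmod -> Prop) (B : gT -> gT -> k) :
    Prop :=
  forall a chi x h, in_subcat R D a chi -> h \in subcat_H R D ->
    B (x^-1 * a * x)%g h =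
      beta a x h * beta a (x * h) x^-1 / beta a x x^-1
      * (chi (x * h * x^-1)%g / chi 1%g).

Definition omega_bicharacter (K H : {set gT}) (B : gT -> gT -> k) : Prop :=
  (forall x y z, x \in K -> y \in H -> z \in H ->
     B x (y * z)%g = (beta x y z)^-1 * B x y * B x z) /\
  (forall v x y, v \in K -> x \in K -> y \in H ->
     B (v * x)%g y = beta y v x * B v y * B x y).

Definition G_invariant (K H : {set gT}) (B : gT -> gT -> k) : Prop :=
  forall x a h, a \in K -> h \in H ->
    B (x^-1 * a * x)%g h =
      beta a x h * beta a (x * h) x^-1 / beta a x x^-1
      * B a (x * h * x^-1)%g.

(* A map K x H -> k^* is stored as its extension by 0 to the whole group, so
   that equality of triples is equality of K, of H and of the maps. *)
Record triple := Triple {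
  tK : {group gT};
  tH : {group gT};
  tB : gT -> gT -> k;
  tK_normal : (tK <| [set: gT])%g;
  tH_normal : (tH <| [set: gT])%g;
  tKH_commute : forall x y, x \in tK -> y \in tH -> (x * y = y * x)%g;
  tB_supp : forall x y, (tB x y != 0) = (x \in tK) && (y \in tH);
  tB_bichar : omega_bicharacter tK tH tB;
  tB_inv : G_invariant tK tH tB
}.

Definition triple_of (R : {set gT}) (D : dmod -> Prop) (t : triple) : Prop :=
  [/\ tK t = subcat_K R D :> {set gT}, tH t = subcat_H R D :> {set gT}
    & is_subcat_B R D (tB t)].

Definition subcat_S (R K H : {set gT}) (B : gT -> gT -> k) (M : dmod) : Prop :=
  exists n (F : 'I_n -> dmod),
    (forall i, exists a chi,
       [/\ in_Gamma R a chi, a \in K, is_simple_at (F i) a chi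
         & {in H, forall h, chi h = B a h * chi 1%g}])
    /\ diso M (dsums F).
End Cocycle.

(* Main.v *)
(**
The scalar action of H on the modules of a fusion subcategory determines it.
For a triple t = (K, H, B), the objects of S(K, H, B) are exactly the modules M
with M(g, h) = B(g, h) M(g, 1) for all g in G and h in H, where M(g, x) is the
action of delta_g xbar; in this form the closure properties are direct
computations.  Conversely, let D be a fusion subcategory, K its support and H
the common kernel of the degree-1 parts of its objects.  Since H acts trivially
on the degree-1 part of M (x) N for M and N in D, it centralizes K and acts on
each M_g by a scalar B(g, h) that does not depend on M in D.

To recover D from (K, H, B), consider the matrix coefficients of its objects, as
functions on the basis of the algebra.  They are closed under sums and under the
convolution dual to the coproduct, and a Stone-Weierstrass argument in degree 1
yields the indicator functions of the cosets of H.  Hence they contain the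
coefficients of every M in S(K, H, B), and a simple module whose coefficients
all come from D belongs to D by averaging.  The regular module, cut by the
idempotent sum_(g in K, h in H) B(g, h)^-1 delta_g hbar / |H|, shows that the
support of S(K, H, B) is K and that its common kernel is H.
*)
From mathcomp Require Import all_boot all_order all_algebra all_fingroup.
From mathcomp Require Import character boolp ring.
Require Import Defs.
Set Implicit Arguments.
Unset Strict Implicit.
Unset Printing Implicit Defensive.
Import GRing.Theory.
Local Open Scope ring_scope.

(** * Intertwiners *)

Section Intertwiners.
Variables (gT : finGroupType) (k : fieldType) (w : cocycle3 gT k).
Local Notation beta := (beta w).
Local Notation dmod := (dmod w).

Lemma dact_id_mul (M : dmod) g x : dact M g 1%g *m dact M g x = dact M g x.
Proof. by rewrite dactM conjg1 eqxx betag1l scale1r mul1g. Qed.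

Lemma dact_mul_id (M : dmod) g x :
  dact M g x *m dact M (g ^ x)%g 1%g = dact M g x.
Proof. by rewrite dactM eqxx betag1 scale1r mulg1. Qed.

Lemma dact_mulE (M : dmod) g x y :
  dact M g x *m dact M (g ^ x)%g y = beta g x y *: dact M g (x * y)%g.
Proof. by rewrite dactM eqxx. Qed.

Lemma dact_mulV (M : dmod) g x :
  dact M g x *m dact M (g ^ x)%g x^-1%g = beta g x x^-1 *: dact M g 1%g.
Proof. by rewrite dact_mulE mulgV. Qed.

(** Since [beta] never vanishes, [dact M g x] is an isomorphism from the degree [g ^ x] part onto
    the degree [g] part, with inverse a multiple of [dact M (g ^ x) x^-1]. *)
Lemma dact_conj_eq0 (M : dmod) g x :
  (dact M (g ^ x)%g 1%g == 0) = (dact M g 1%g == 0).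
Proof.
suff imp (a y : gT) : dact M (a ^ y)%g 1%g = 0 -> dact M a 1%g = 0.
  apply/eqP/eqP; first exact: imp.
  by move=> E; apply: (imp _ x^-1%g); rewrite conjgK.
move=> E; apply/eqP; have := dact_mulV M a y.
rewrite -[dact M a y]dact_mul_id E mulmx0 mul0mx => /esym/eqP.
by rewrite scaler_eq0 (negPf (beta_neq0 _ _ _ _)).
Qed.

Lemma dact_eq0 (M : dmod) g x : (dact M g x == 0) = (dact M g 1%g == 0).
Proof.
apply/eqP/eqP => [E|E]; last by rewrite -dact_id_mul E mul0mx.
apply/eqP; have := dact_mulV M g x; rewrite E mul0mx => /esym/eqP.
by rewrite scaler_eq0 (negPf (beta_neq0 _ _ _ _)).
Qed.

Definition dhom (M N : dmod) (f : 'M[k]_(ddim N, ddim M)) : Prop :=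
  forall g x, f *m dact M g x = dact N g x *m f.

Lemma dhom1 (M : dmod) : dhom (1%:M : 'M_(ddim M)).
Proof. by move=> g x; rewrite mul1mx mulmx1. Qed.

Lemma dhom_comp (M N P : dmod) (f : 'M_(ddim N, ddim M)) (g : 'M_(ddim P, ddim N)) :
  dhom f -> dhom g -> dhom (g *m f).
Proof. by move=> hf hg a x; rewrite -mulmxA hf mulmxA hg mulmxA. Qed.

(** The twisted Reynolds operator: the factor [(beta g x x^-1)^-1] turns [dact M (g ^ x) x^-1] into
    the inverse of [dact M g x], so [f] is averaged over genuine conjugations between degrees. *)
Definition davg (M N : dmod) (f : 'M[k]_(ddim N, ddim M)) :=
  \sum_g \sum_x
    (beta g x x^-1)^-1 *: (dact N g x *m f *m dact M (g ^ x)%g x^-1%g).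

(** Two instances of the cocycle identity share the factor [beta h z (z^-1 * y)]; eliminating it
    gives exactly the ratio needed when the average is shifted by [y]. *)
Lemma beta_avg h y z :
  beta (h ^ z) z^-1 y * beta (h ^ y) (y^-1 * z) (z^-1 * y)
  = beta h z z^-1 * beta h y (y^-1 * z).
Proof.
have E1 := beta_cocycle w h y (y^-1 * z) (z^-1 * y).
have E2 := beta_cocycle w h z z^-1 y.
have e1 : (y^-1 * z * (z^-1 * y) = 1)%g by rewrite mulgA mulgK mulVg.
rewrite mulKVg e1 betag1 mul1r in E1.
rewrite mulgV betag1l mulr1 in E2.
by rewrite -E1 E2; ring.
Qed.

Lemma davg_hom (M N : dmod) f : dhom (@davg M N f).
Proof.
move=> h y.
have -> : davg f *m dact M h y
  = \sum_x ((beta h x x^-1)^-1 * beta (h ^ x) x^-1 y)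
       *: (dact N h x *m f *m dact M (h ^ x)%g (x^-1 * y)%g).
  rewrite mulmx_suml (bigD1 h) //= [X in _ + X]big1 ?addr0 => [|g ne].
    rewrite mulmx_suml; apply: eq_bigr => x _.
    rewrite -scalemxAl -[X in _ *: X]mulmxA dactM -conjgM mulgV conjg1 eqxx.
    by rewrite -scalemxAr scalerA.
  rewrite mulmx_suml big1 // => x _.
  rewrite -scalemxAl -[X in _ *: X]mulmxA dactM -conjgM mulgV conjg1.
  by rewrite eq_sym (negPf ne) mulmx0 scaler0.
rewrite /davg mulmx_sumr [RHS](bigD1 (h ^ y)%g) //= [X in _ + X]big1 ?addr0 =>
  [|g ne].
  rewrite mulmx_sumr [RHS](reindex_inj (mulgI y^-1%g)) /=; apply: eq_bigr => z _.
  rewrite -scalemxAr !mulmxA dact_mulE mulKVg -!scalemxAl scalerA.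
  rewrite invMg invgK -conjgM mulKVg; congr (_ *: _).
  apply/eqP; rewrite mulrC [eqbRHS]mulrC eqr_div ?beta_neq0 //.
  by rewrite beta_avg mulrC.
rewrite mulmx_sumr big1 // => x _.
by rewrite -scalemxAr !mulmxA dactM (negPf ne) !mul0mx scaler0.
Qed.

Lemma davg_compl (M N P : dmod) (f : 'M_(ddim N, ddim M))
    (e : 'M_(ddim P, ddim N)) : dhom e -> davg (e *m f) = e *m davg f.
Proof.
move=> he; rewrite /davg mulmx_sumr; apply: eq_bigr => g _.
rewrite mulmx_sumr; apply: eq_bigr => x _.
by rewrite -scalemxAr !mulmxA he.
Qed.

Lemma davg_id (M : dmod) : @davg M M 1%:M = #|gT|%:R%:M.
Proof.
have E g : \sum_x (beta g x x^-1)^-1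
    *: (dact M g x *m 1%:M *m dact M (g ^ x)%g x^-1%g) = #|gT|%:R *: dact M g 1%g.
  rewrite (eq_bigr (fun=> dact M g 1%g)) => [|x _]; last first.
    by rewrite mulmx1 dact_mulV scalerA mulVf ?beta_neq0 // scale1r.
  by rewrite sumr_const scaler_nat.
by rewrite /davg (eq_bigr _ (fun g _ => E g)) -scaler_sumr dact1 scalemx1.
Qed.

Lemma diso_inv (M N : dmod) : diso M N ->
  exists (f : 'M_(ddim N, ddim M)) (s : 'M_(ddim M, ddim N)),
    [/\ dhom f, dhom s, f *m s = 1%:M & s *m f = 1%:M].
Proof.
case=> f [ff fu hf]; have fs := mulmxVp ff.
have sf : pinvmx f *m f = 1%:M.
  by rewrite -[pinvmx f]mul1mx mulmxKpV // submx_full.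
exists f, (pinvmx f); split=> // g x.
by rewrite -[LHS]mulmx1 -fs mulmxA -(mulmxA _ _ f) -hf !mulmxA sf mul1mx.
Qed.

Lemma dhom_diso (M N : dmod) (f : 'M_(ddim N, ddim M)) (s : 'M_(ddim M, ddim N)) :
  dhom f -> f *m s = 1%:M -> s *m f = 1%:M -> diso M N.
Proof.
move=> hf fs sf; exists f; split=> //.
  by apply/row_freeP; exists s.
by apply/row_fullP; exists s.
Qed.

Lemma diso_sym (M N : dmod) : diso M N -> diso N M.
Proof. by case/diso_inv=> f [s [hf hs fs sf]]; apply: (dhom_diso hs sf fs). Qed.

Lemma diso_trans (M N P : dmod) : diso M N -> diso N P -> diso M P.
Proof.
case/diso_inv=> f [s [hf hs fs sf]] /diso_inv[f' [s' [hf' hs' fs' sf']]].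
apply: (dhom_diso (s := s *m s') (dhom_comp hf hf')).
  by rewrite mulmxA -(mulmxA f') fs mulmx1.
by rewrite mulmxA -(mulmxA s) sf' mulmx1.
Qed.

Lemma diso_dsumr (M N N' : dmod) : diso N N' -> diso (dsum M N) (dsum M N').
Proof.
case/diso_inv=> f [s [hf hs fs sf]].
apply: (@dhom_diso (dsum M N) (dsum M N') (block_mx 1%:M 0 0 f)
          (block_mx 1%:M 0 0 s)).
- move=> g x; rewrite /= /dsum_act !mulmx_block !mul0mx !mulmx0 !mulmx1 !mul1mx.
  by rewrite !addr0 !add0r hf.
- by rewrite mulmx_block !mul0mx !mulmx0 mulmx1 !addr0 !add0r fs -scalar_mx_block.
- by rewrite mulmx_block !mul0mx !mulmx0 mulmx1 !addr0 !add0r sf -scalar_mx_block.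
Qed.

(** In a rank factorization [e = i *m p], the outer factors of [i p i p = i p] can be cancelled,
    because [i] has a left inverse and [p] a right inverse. *)
Lemma idem_factor n (e : 'M[k]_n) : e *m e = e ->
  exists (p : 'M_(\rank e, n)) (i : 'M_(n, \rank e)), p *m i = 1%:M /\ i *m p = e.
Proof.
move=> ee; exists (row_base e), (col_base e); split; last exact: mulmx_base.
move: (row_base_free e) (col_base_full e) (mulmx_base e) ee.
move: (\rank e) (row_base e) (col_base e).
move=> d p i /row_freeP[r pr] /row_fullP[l li] ip ee.
have : l *m (e *m e) *m r = l *m e *m r by rewrite ee.
by rewrite -ip !mulmxA li !mul1mx -mulmxA pr mulmx1.
Qed.

Lemma idem_split (M : dmod) (e : 'M_(ddim M)) : dhom e -> e *m e = e ->
  exists (N : dmod) (p : 'M_(ddim N, ddim M)) (i : 'M_(ddim M, ddim N)),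
    [/\ dhom p, dhom i, p *m i = 1%:M, i *m p = e & ddim N = \rank e].
Proof.
move=> he ee; have [] := idem_factor ee.
move Er: (\rank e) => r p [i [pi ip]].
have ei : e *m i = i by rewrite -ip -mulmxA pi mulmx1.
have pe : p *m e = p by rewrite -ip mulmxA pi mul1mx.
pose act g x := p *m dact M g x *m i.
have actM g x h y : act g x *m act h y
    = if h == (g ^ x)%g then beta g x y *: act g (x * y)%g else 0.
  rewrite /act !mulmxA -(mulmxA _ i p) ip -(mulmxA p) -he mulmxA pe.
  rewrite -(mulmxA p) dactM; case: eqP => _; last by rewrite mulmx0 mul0mx.
  by rewrite -scalemxAr -scalemxAl.
have act1 : \sum_g act g 1%g = 1%:M.
  by rewrite -mulmx_suml -mulmx_sumr dact1 mulmx1.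
exists (DMod actM act1), p, i; split=> //= g x; rewrite /act.
  by rewrite -!mulmxA ip -he !mulmxA pe.
by rewrite !mulmxA ip he -mulmxA ei.
Qed.

(** The complement is the image of the idempotent [1 - s f]. This turns a retract into a literal
    [dsum], the only form in which closure under summands is available. *)
Lemma retract_dsum (M N : dmod) (f : 'M_(ddim N, ddim M)) (s : 'M_(ddim M, ddim
  N)) :
  dhom f -> dhom s -> f *m s = 1%:M -> exists N', diso M (dsum N N').
Proof.
move=> hf hs fs.
pose e := 1%:M - s *m f.
have he : dhom e.
  by move=> g x; rewrite mulmxBl mulmxBr mul1mx mulmx1 (dhom_comp hf hs).
have fe : f *m e = 0 by rewrite mulmxBr mulmx1 mulmxA fs mul1mx subrr.
have es : e *m s = 0 by rewrite mulmxBl mul1mx -mulmxA fs mulmx1 subrr.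
have ee : e *m e = e by rewrite {1}/e mulmxBl mul1mx -mulmxA fe mulmx0 subr0.
have [N' [p [i [hp hi pi ip _]]]] := idem_split he ee.
have fi : f *m i = 0 by rewrite -[i]mulmx1 -pi !mulmxA -(mulmxA f) ip fe mul0mx.
have ps : p *m s = 0 by rewrite -[p]mul1mx -pi -!mulmxA (mulmxA i) ip es mulmx0.
exists N'.
apply: (@dhom_diso _ (dsum N N') (col_mx f p) (row_mx s i)).
- by move=> g x; rewrite mul_block_col !mul0mx addr0 add0r mul_col_mx hf hp.
- by rewrite mul_col_row fs fi ps pi -scalar_mx_block.
- by rewrite mul_row_col ip addrC subrK.
Qed.

End Intertwiners.

(** * Complete reducibility *)

Section Maschke.
Variables (gT : finGroupType) (k : fieldType) (w : cocycle3 gT k).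
Hypothesis char0 : [pchar k] =i pred0.
Local Notation dmod := (dmod w).

Lemma natr_neq0 n : (0 < n)%N -> n%:R != 0 :> k.
Proof. by rewrite lt0n; have /pcharf0P -> := char0. Qed.

Lemma card_neq0 : #|gT|%:R != 0 :> k.
Proof. by rewrite natr_neq0 // -cardsT; apply: (cardG_gt0 [set: gT]%G). Qed.

(** Maschke's argument: [i *m p] is a linear projection onto the subspace, and its average divided
    by the group order is still a projection onto it but commutes with the action. *)
Lemma stable_idem (M : dmod) (U : 'M_(ddim M)) :
  (forall g x, stablemx U (dact M g x)^T) ->
  exists e : 'M_(ddim M), [/\ dhom e, e *m e = e & \rank e = \rank U].
Proof.
move=> st.
pose i := (row_base U)^T; pose p := (pinvmx (row_base U))^T.
have pi : p *m i = 1%:M.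
  by rewrite -trmx_mul mulmxVp ?row_base_free // trmx1.
have ipi g x : i *m (p *m (dact M g x *m i)) = dact M g x *m i.
  apply: trmx_inj; rewrite !trmx_mul !trmxK.
  by rewrite mulmxKpV // stablemx_row_base.
pose e := #|gT|%:R^-1 *: davg (M := M) (N := M) (i *m p).
have ei : e *m i = i.
  have -> : e *m i = #|gT|%:R^-1 *: (davg (M := M) (N := M) 1%:M *m i).
    rewrite -scalemxAl /davg !mulmx_suml; congr (_ *: _); apply: eq_bigr => g _.
    rewrite !mulmx_suml; apply: eq_bigr => x _.
    by rewrite -!scalemxAl mulmx1 -!mulmxA ipi.
  by rewrite davg_id mul_scalar_mx scalerA mulVf ?card_neq0 // scale1r.
have ipe : i *m p *m e = e.
  rewrite -scalemxAr /davg mulmx_sumr; congr (_ *: _); apply: eq_bigr => g _.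
  rewrite mulmx_sumr; apply: eq_bigr => x _.
  by rewrite -scalemxAr !mulmxA -[i *m p *m _ *m i]mulmxA -[_ *m _ *m (_ *m
    i)]mulmxA ipi.
exists e; split.
- by move=> g x; rewrite -scalemxAl davg_hom scalemxAr.
- by rewrite -{2}ipe !mulmxA ei ipe.
- have ri : \rank i = \rank U by rewrite mxrank_tr eq_row_base.
  have le1 : (\rank e <= \rank i)%N by rewrite -{1}ipe -mulmxA mxrankM_maxl.
  have le2 : (\rank i <= \rank e)%N by rewrite -{1}ei mxrankM_maxl.
  by apply/eqP; rewrite eqn_leq -{1}ri le1 /= -ri.
Qed.

Lemma simple_retract (M : dmod) : (0 < ddim M)%N ->
  exists (N : dmod) (p : 'M_(ddim N, ddim M)) (i : 'M_(ddim M, ddim N)),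
    [/\ dsimple N, dhom p, dhom i & p *m i = 1%:M].
Proof.
have [n] := ubnP (ddim M); elim: n M => // n IH M; rewrite ltnS => leM M0.
have [sM|nsM] := pselect (dsimple M).
  by exists M, 1%:M, 1%:M; split; rewrite ?mulmx1 //; apply: dhom1.
have [U [st U0 Uf]] : exists U : 'M_(ddim M),
    [/\ forall g x, stablemx U (dact M g x)^T, U != 0 & ~~ row_full U].
  apply: contrapT => H; apply: nsM; split=> // U st.
  have [->|U0] := eqVneq U 0; [by left | right].
  apply: contrapT => /negP Uf; apply: H; exists U; split=> // g x.
  exact: (st (g, x)).
have [e [he ee re]] := stable_idem st.
have [N [p [i [hp hi pi _ rN]]]] := idem_split he ee.
have ltN : (ddim N < ddim M)%N.
  by rewrite rN re ltn_neqAle Uf rank_leq_col.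
have N0 : (0 < ddim N)%N by rewrite rN re lt0n mxrank_eq0.
have [P [p' [i' [sP hp' hi' p'i']]]] := IH N (leq_trans ltN leM) N0.
exists P, (p' *m p), (i *m i'); split=> //; try exact: dhom_comp.
by rewrite mulmxA -(mulmxA p') pi mulmx1.
Qed.

Lemma diso_ddim (M N : dmod) : diso M N -> ddim M = ddim N.
Proof. by case=> f [/eqP ff /eqP fu _]; rewrite -ff fu. Qed.

Lemma dsums_cons (N : dmod) n (F : 'I_n -> dmod) :
  dsums (fun i : 'I_n.+1 => if unlift ord0 i is Some j then F j else N)
  = dsum N (dsums F).
Proof.
rewrite /dsums big_ord_recl unlift_none; congr dsum.
by apply: eq_bigr => i _; rewrite liftK.
Qed.

Lemma semisimple (M : dmod) : exists n (F : 'I_n -> dmod),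
  (forall i, dsimple (F i)) /\ diso M (dsums F).
Proof.
have [d] := ubnP (ddim M); elim: d M => // d IH M; rewrite ltnS => leM.
have [M0|M0] := posnP (ddim M).
  exists 0%N, (fun=> M); split=> [[]//|]; rewrite /dsums big_ord0.
  exists 0; split; rewrite /row_free /row_full ?mxrank0 ?M0 // => g x.
  by rewrite mul0mx mulmx0.
have [N [p [i [sN hp hi pi]]]] := simple_retract M0.
have [N' isoM] := retract_dsum hp hi pi.
have dM : ddim M = (ddim N + ddim N')%N by rewrite (diso_ddim isoM).
have [|n [F [sF isoF]]] := IH N'.
  by apply: leq_trans leM; rewrite dM -addn1 addnC leq_add2r; case: sN.
exists n.+1, (fun i => if unlift ord0 i is Some j then F j else N); split.
  by move=> j; case: unliftP.
by rewrite dsums_cons; apply: diso_trans isoM _; apply: diso_dsumr.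
Qed.

Lemma dsums_summand (P : dmod -> Prop) :
  (forall M N, P (dsum M N) -> P M /\ P N) ->
  forall n (F : 'I_n -> dmod), P (dsums F) -> forall i, P (F i).
Proof.
move=> PS; elim=> [|n IH] F; first by move=> _ [].
rewrite /dsums big_ord_recl => /PS[P0 PF] i.
by case: (unliftP ord0 i) => [j|] ->; [exact: (IH (fun j => F (lift ord0 j))) |].
Qed.

Lemma retract_fobj (D : fusion_subcat w) (M N : dmod) (f : 'M_(ddim N, ddim M))
    (s : 'M_(ddim M, ddim N)) :
  dhom f -> dhom s -> f *m s = 1%:M -> D M -> D N.
Proof.
move=> hf hs fs DM; have [N' iso] := retract_dsum hf hs fs.
by case: (fobj_summand (fobj_iso iso DM)).
Qed.

(** The image of [f], encoded as the row space of [f^T], is a nonzero submodule and hence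
    everything. Averaging a linear section gives an equivariant one, since the equivariant [f] can
    be pulled out of the average. *)
Lemma dhom_simple_section (W M : dmod) (f : 'M_(ddim M, ddim W)) :
  dsimple M -> dhom f -> f != 0 ->
  exists s : 'M_(ddim W, ddim M), dhom s /\ f *m s = 1%:M.
Proof.
move=> [_ sM] hf f0.
have [|U0|/row_fullP[s0 s0f]] := sM <<f^T>>%MS.
- move=> [g x] _ /=; rewrite (eqmxMr _ (genmxE _)) genmxE -trmx_mul -hf.
  by rewrite trmx_mul submxMl.
- case/eqP: f0; apply: trmx_inj; apply/eqP.
  by rewrite trmx0 -mxrank_eq0 -mxrank_gen U0 mxrank0.
have /row_fullP[t tf] : row_full f^T.
  by rewrite /row_full -mxrank_gen; apply/row_fullP; exists s0.
exists (#|gT|%:R^-1 *: davg (M := M) (N := W) t^T); split.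
  by move=> g x; rewrite -scalemxAl davg_hom scalemxAr.
rewrite -scalemxAr -davg_compl // -[f]trmxK -trmx_mul tf trmx1 davg_id.
by rewrite scale_scalar_mx mulVf ?card_neq0.
Qed.

End Maschke.

(** For an eigenvalue [c], a nonzero [f - c] would have a right inverse, and this would kill the
    eigenvector. *)
Lemma schur (gT : finGroupType) (k : closedFieldType)
    (char0 : [pchar k] =i pred0) (w : cocycle3 gT k) (M : dmod w)
    (f : 'M_(ddim M)) :
  dsimple M -> dhom (N := M) f -> exists c, f = c%:M.
Proof.
move=> sM hf; have M0 : (0 < ddim M)%N by case: sM.
have /closed_rootP[c] : size (char_poly f) != 1%N.
  by rewrite size_char_poly eqSS -lt0n.
rewrite -eigenvalue_root_char => /eigenvalueP[v vf v0]; exists c.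
apply: contrapT => /eqP; rewrite -subr_eq0 => fc0.
have [|s [_ fs]] := dhom_simple_section char0 sM _ fc0.
  by move=> g x; rewrite mulmxBl mulmxBr hf scalar_mxC.
case/eqP: v0; rewrite -[v]mulmx1 -fs mulmxA mulmxBr vf mul_mx_scalar.
by rewrite subrr mul0mx.
Qed.

(** * Simple modules *)

Section SimpleObjects.
Variables (gT : finGroupType) (k : fieldType) (w : cocycle3 gT k).
Local Notation beta := (beta w).
Local Notation dmod := (dmod w).

Lemma cent1_conjg (a x : gT) : (x \in 'C[a]%g) = (a ^ x == a)%g.
Proof.
apply/cent1P/eqP => [xa|E]; first by rewrite conjgE -xa mulKg.
by rewrite /commute [RHS]conjgC E.
Qed.

(** A proper nonzero submodule of the degree [a] part would generate a proper nonzero submodule of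
    [M], because generating and then projecting back to degree [a] adds nothing. *)
Lemma simple_affords (M : dmod) a : dsimple M -> dact M a 1%g != 0 ->
  exists chi, is_simple_at M a chi /\ irr_char w a chi.
Proof.
move=> sM Ma0.
have [P [V [PV VP]]] := idem_factor (dact_id_mul M a 1%g).
have rk0 : (0 < \rank (dact M a 1%g))%N by rewrite lt0n mxrank_eq0.
move: (\rank _) P V PV VP rk0 => r P V PV VP r0.
pose act x := P *m dact M a x *m V.
have MaV x : dact M a x *m V = V *m act x.
  by rewrite /act !mulmxA VP dact_id_mul.
have actM : {in 'C[a]%g &, forall x y, act x *m act y = beta a x y *: act (x *
  y)%g}.
  move=> x y; rewrite cent1_conjg => /eqP ax _.
  have := dact_mulE M a x y; rewrite ax => E.
  by rewrite /act -!mulmxA (mulmxA V) VP (mulmxA _ _ V) dact_id_mul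
     (mulmxA _ (dact M a y)) E -scalemxAl -scalemxAr.
have act1 : act 1%g = 1%:M by rewrite /act -VP !mulmxA PV mul1mx PV.
pose N := TMod actM act1.
exists (tchar N).
split; last first.
  exists N => //; split=> //= U st.
  (* [S] is the submodule of [M] generated by the image of [U] in degree [a]. *)
  pose S := (\sum_(q : gT * gT) <<U *m V^T *m (dact M q.1 q.2)^T>>)%MS.
  have [|S0|Sf] := sM.2 S.
  - move=> [h y] _ /=; rewrite sumsmxMr; apply/sumsmx_subP => -[g x] _.
    rewrite (eqmxMr _ (genmxE _)) /= -mulmxA -trmx_mul dactM.
    case: eqP => _; last by rewrite trmx0 mulmx0 sub0mx.
    rewrite linearZ /= -scalemxAr; apply: scalemx_sub.
    by apply: (sumsmx_sup (h, y * x)%g) => //=; rewrite genmxE.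
  - left; apply/eqP.
    suff: (U *m V^T <= S)%MS.
      rewrite S0 => /submxP[D UV].
      by rewrite -[U]mulmx1 -trmx1 -PV trmx_mul mulmxA UV mulmx0 mul0mx.
    apply: (sumsmx_sup (a, 1%g)) => //=; rewrite genmxE -VP -mulmxA -trmx_mul.
    by rewrite -mulmxA PV mulmx1.
  - right.
    (* Projected to degree [a], the generator [delta_g xbar] contributes only for [g = a] and [x]
       centralizing [a], and there [U] is stable. *)
    have: (1%:M *m (dact M a 1%g)^T *m P^T <= U)%MS.
      have: (1%:M <= S)%MS by rewrite sub1mx.
      move=> /(submxMr ((dact M a 1%g)^T *m P^T)).
      rewrite mulmxA => /submx_trans; apply.
      rewrite sumsmxMr_gen; apply/sumsmx_subP => -[g x] _.
      rewrite genmxE (eqmxMr _ (genmxE _)) /= -!mulmxA -!trmx_mul.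
      have [->|ne] := eqVneq g a; last first.
        by rewrite -(mulmxA P) dactM conjg1 (negPf ne) mulmx0 mul0mx trmx0
          mulmx0 sub0mx.
      have [Cx|nCx] := boolP (x \in 'C[a]%g);
        first by rewrite -(mulmxA P) dact_id_mul; exact: st.
      rewrite -(mulmxA P) dact_id_mul.
      have -> : V = dact M a 1%g *m V by rewrite -VP -mulmxA PV mulmx1.
      rewrite mulmxA -(mulmxA P) dactM eq_sym -cent1_conjg (negPf nCx).
      by rewrite mulmx0 mul0mx trmx0 mulmx0 sub0mx.
    rewrite mul1mx -trmx_mul -VP mulmxA PV mul1mx => PU.
    rewrite -sub1mx; apply: submx_trans PU.
    have -> : 1%:M = V^T *m P^T by rewrite -trmx_mul PV trmx1.
    exact: submxMl.
split=> //; exists N, V; split=> //.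
- by apply/row_freeP; exists P^T; rewrite -trmx_mul PV trmx1.
- apply/eqmxP; rewrite -VP trmx_mul submxMl andbT.
  by rewrite -[X in (X <= _)%MS]mul1mx -trmx1 -PV trmx_mul -mulmxA submxMl.
Qed.

End SimpleObjects.

(** * The subcategory of a triple *)

Section TripleSubcat.
Variables (gT : finGroupType) (k : fieldType) (w : cocycle3 gT k).
Local Notation beta := (beta w).
Local Notation gamma := (gamma w).
Local Notation dmod := (dmod w).

(** This bridges the coproduct, which involves [gamma], and the bicharacter law in the first
    variable, which involves [beta]. *)
Lemma gamma_commE (a x y : gT) : (x ^ a)%g = x -> (y ^ a)%g = y ->
  gamma a x y = beta a x y.
Proof.
move=> xa ya; have fixC u : (u ^ a)%g = u -> (a ^ u)%g = a.
  move=> ua; apply/eqP; rewrite -cent1_conjg; apply/cent1P.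
  by rewrite /commute conjgC ua.
have ax := fixC x xa; have axy : (a ^ (x * y))%g = a by rewrite conjgM ax fixC.
by rewrite /gamma /beta ax axy xa ya [w x y a * _]mulrC.
Qed.

Section Triple.
Variable t : triple w.
Local Notation K := (tK t).
Local Notation H := (tH t).
Local Notation B := (tB t).

Lemma tB_out g h : g \notin K -> B g h = 0.
Proof. by move=> gK; apply/eqP; rewrite -[_ == _]negbK tB_supp (negPf gK). Qed.

Lemma tB_neq0 g h : g \in K -> h \in H -> B g h != 0.
Proof. by move=> gK hH; rewrite tB_supp gK. Qed.

Lemma tB_g1 g : g \in K -> B g 1%g = 1.
Proof.
move=> gK; have [+ _] := tB_bichar t => /(_ g 1%g 1%g gK (group1 _) (group1 _)).
rewrite mulg1 betag1 invr1 mul1r => E.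
by apply: (mulfI (tB_neq0 gK (group1 _))); rewrite -E mulr1.
Qed.

Lemma tB_1h h : h \in H -> B 1%g h = 1.
Proof.
move=> hH; have [_ +] := tB_bichar t => /(_ 1%g 1%g h (group1 _) (group1 _) hH).
rewrite mulg1 betag1 mul1r => E.
by apply: (mulfI (tB_neq0 (group1 _) hH)); rewrite -E mulr1.
Qed.

Lemma tK_conj g x : ((g ^ x)%g \in K) = (g \in K).
Proof. by rewrite memJ_norm // (subsetP (normal_norm (tK_normal t))) ?inE. Qed.

Lemma tH_conj h x : ((h ^ x)%g \in H) = (h \in H).
Proof. by rewrite memJ_norm // (subsetP (normal_norm (tH_normal t))) ?inE. Qed.

Lemma tKH_conjl g h : g \in K -> h \in H -> (g ^ h)%g = g.
Proof. by move=> gK hH; rewrite conjgE (tKH_commute gK hH) mulKg. Qed.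

(** Invariance in the form that compares the two ways of reaching [dact M g (h * x)], using
    [h * x = x * h ^ x]; no inverses remain. *)
Lemma tB_conj g h x : g \in K -> h \in H ->
  B g h = beta g h x / beta g x (h ^ x) * B (g ^ x)%g (h ^ x)%g.
Proof.
move=> gK hH.
have BE := tB_inv x gK (etrans (tH_conj h x) hH).
rewrite -conjgC mulgK -mulgA -conjgE in BE.
have bE := beta_cocycle w g h x x^-1.
rewrite mulgV betag1 mul1r (tKH_conjl gK hH) in bE.
have b1 := beta_neq0 w g h x; have b2 := beta_neq0 w g x (h ^ x)%g.
have b3 := beta_neq0 w g (h * x) x^-1.
by rewrite BE -bE; field; rewrite b1 b2 b3.
Qed.

(** Since [B] is zero outside [K], the case [h = 1] already forces the support of [M] into [K]. *)
Definition tsub (M : dmod) : Prop :=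
  forall g h, h \in H -> dact M g h = B g h *: dact M g 1%g.

Lemma tsub_out (M : dmod) g x : tsub M -> g \notin K -> dact M g x = 0.
Proof.
move=> tM gK; apply/eqP; rewrite dact_eq0.
by rewrite tM // tB_out // scale0r.
Qed.

Lemma tsub_iso (M N : dmod) : diso M N -> tsub M -> tsub N.
Proof.
case/diso_inv=> f [s [hf hs fs sf]] tM g h hH.
by rewrite -[LHS]mulmx1 -[X in _ *: X]mulmx1 -fs !mulmxA -!hf tM // -scalemxAr
  !scalemxAl.
Qed.

Lemma tsub_unit : tsub (dunit w).
Proof.
move=> g h hH; rewrite /= /dunit_act; have [->|_] := eqVneq g 1%g.
  by rewrite tB_1h // scale1r.
by rewrite scale_scalar_mx mulr0.
Qed.

Lemma tsub_dsum (M N : dmod) : tsub M -> tsub N -> tsub (dsum M N).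
Proof.
move=> tM tN g h hH; rewrite /= /dsum_act scale_block_mx !scaler0.
by rewrite tM // tN.
Qed.

Lemma tsub_dsums n (F : 'I_n -> dmod) : (forall i, tsub (F i)) -> tsub (dsums F).
Proof.
move=> tF; rewrite /dsums; elim/big_ind: _ => [||i _] //; last exact: tsub_dsum.
by move=> g h _; rewrite /= scaler0.
Qed.

Lemma tsub_summand (M N : dmod) : tsub (dsum M N) -> tsub M /\ tsub N.
Proof.
move=> tMN; split=> g h hH; have := tMN g h hH;
  by rewrite /= /dsum_act scale_block_mx !scaler0 => /eq_block_mx[].
Qed.

(** Summands of the coproduct outside [K] vanish; on the others the claim is the multiplicativity of
    [B] in its first variable. *)
Lemma tsub_tensor (M N : dmod) : tsub M -> tsub N -> tsub (dtensor M N).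
Proof.
move=> tM tN g h hH; rewrite /= /dtensor_act scaler_sumr.
apply: eq_bigr => -[p q] /= /eqP <-.
have [pK|pK] := boolP (p \in K); last by rewrite !(tsub_out _ tM pK) !tprod0l
  !scaler0.
have [qK|qK] := boolP (q \in K); last by rewrite !(tsub_out _ tN qK) !tprod0r
  !scaler0.
rewrite tM // tN // tprodZ !scalerA gammag1 mulr1 gamma_commE ?tKH_conjl //.
by have [_ ->] := tB_bichar t; rewrite // mulrA.
Qed.

Lemma tsub_dual (M : dmod) : tsub M -> tsub (ddual M).
Proof.
move=> tM g h hH; rewrite /= /ddual_act.
have [gK|gK] := boolP (g \in K); last first.
  by rewrite !tsub_out ?trmx0 ?scaler0 // tK_conj groupV.
have gVK : g^-1%g \in K by rewrite groupV.
have hVH : h^-1%g \in H by rewrite groupV.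
rewrite gammag1 betag1l mulr1 invr1 scale1r conjg1 invg1 tKH_conjl //.
rewrite tM // [(_ *: _)^T]linearZ /= scalerA; congr (_ *: _).
(* The dual acts by [B g^-1 h^-1] divided by the two antipode factors. Multiplicativity of [B] at
   inverse arguments, once in each variable, expresses these factors through values of [B]. *)
have E1 : B g^-1%g h * B g^-1%g h^-1%g = beta g^-1 h h^-1.
  have [+ _] := tB_bichar t => /(_ _ _ _ gVK hH hVH).
  rewrite mulgV tB_g1 // -mulrA => E.
  by apply: (mulfI (invr_neq0 (beta_neq0 w g^-1%g h h^-1%g)));
    rewrite -E mulVf ?beta_neq0.
have E2 : beta h g g^-1 * B g h * B g^-1%g h = 1.
  by have [_ <-] := tB_bichar t; rewrite // mulgV tB_1h.
rewrite gamma_commE ?tKH_conjl // -E1.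
have b1 := tB_neq0 gK hH; have b2 := tB_neq0 gVK hH; have b3 := tB_neq0 gVK hVH.
have b4 := beta_neq0 w h g g^-1%g.
have -> : beta h g g^-1 = (B g h * B g^-1%g h)^-1.
  by apply: (mulIf (mulf_neq0 b1 b2)); rewrite mulVf ?mulf_neq0 // mulrA.
by field; rewrite b1 b2 b3.
Qed.

Definition tsubcat : fusion_subcat w :=
  FusionSubcat tsub_iso tsub_unit tsub_dsums tsub_summand tsub_tensor tsub_dual.

End Triple.

Lemma affords_dim (M : dmod) a chi :
  [pchar k] =i pred0 -> is_simple_at M a chi -> chi 1%g != 0.
Proof.
move=> char0 [_ Ma0 [N [V [fV VM _ ->]]]]; rewrite ffunE group1 tact1 mxtrace1.
apply: natr_neq0 => //; rewrite lt0n; apply: contraNneq Ma0 => d0.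
rewrite -(inj_eq trmx_inj) trmx0 -mxrank_eq0 -VM -leqn0 -d0; exact: rank_leq_row.
Qed.

Lemma affords_scalar (M : dmod) a chi x c : x \in 'C[a]%g -> affords M a chi ->
  dact M a x = c *: dact M a 1%g -> chi x = c * chi 1%g.
Proof.
move=> Cx [N [V [/row_freeP[D VD] _ MV ->]]] E.
rewrite !ffunE Cx group1; have EV := MV x Cx.
rewrite E -scalemxAl MV ?group1 // tact1 mulmx1 -[V in c *: V]mulmx1 scalemxAr
  in EV.
have DV : D^T *m V = 1%:M by rewrite -[V]trmxK -trmx_mul VD trmx1.
have := congr1 (mulmx D^T) EV; rewrite !mulmxA DV !mul1mx => <-.
by rewrite mxtraceZ tact1.
Qed.

(** A simple module is generated by its nonzero degree [a] part, so a linear map is determined by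
    its values on the translates of that part. *)
Lemma simple_ext0 m (M : dmod) a (C : 'M_(m, ddim M)) :
  dsimple M -> dact M a 1%g != 0 ->
  (forall g x, C *m dact M g x *m dact M a 1%g = 0) -> C = 0.
Proof.
move=> sM Ma0 C0.
pose S := (\sum_(q : gT * gT) <<(dact M q.1 q.2 *m dact M a 1%g)^T>>)%MS.
have [|S0|Sf] := sM.2 S.
- move=> [h y] _ /=; rewrite sumsmxMr; apply/sumsmx_subP => -[g x] _.
  rewrite (eqmxMr _ (genmxE _)) /= -trmx_mul mulmxA dactM.
  case: eqP => _; last by rewrite mul0mx trmx0 sub0mx.
  rewrite -scalemxAl linearZ /=; apply: scalemx_sub.
  by apply: (sumsmx_sup (h, y * x)%g) => //=; rewrite genmxE.
- case/eqP: Ma0; apply: trmx_inj; rewrite trmx0; apply/eqP.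
  rewrite -submx0 -S0; apply: (sumsmx_sup (a, 1%g)) => //=.
  by rewrite genmxE dact_id_mul.
have: (1%:M <= S)%MS by rewrite sub1mx.
move=> /(submxMr C^T); rewrite mul1mx => CS.
apply: trmx_inj; rewrite trmx0; apply/eqP; rewrite -(mxrank_eq0 C^T) -leqn0.
apply: leq_trans (mxrankS CS) _.
suff -> : S *m C^T = 0 by rewrite mxrank0.
apply/eqP; rewrite -mxrank_eq0 -leqn0.
rewrite sumsmxMr_gen big1 ?mxrank0 // => -[g x] _.
apply/eqP; rewrite -mxrank_eq0 mxrank_gen (eqmxMr _ (genmxE _)) /=.
by rewrite -trmx_mul mulmxA C0 trmx0 mxrank0.
Qed.

End TripleSubcat.

(** * Comparison of the scalar condition with [subcat_S] *)

Section SubcatS.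
Variables (gT : finGroupType) (k : fieldType) (w : cocycle3 gT k).
Hypothesis char0 : [pchar k] =i pred0.
Local Notation beta := (beta w).
Local Notation dmod := (dmod w).

(** The trace of an idempotent is its rank, and in characteristic zero the trace determines this
    integer. *)
Lemma idem_trace_full n (E : 'M[k]_n) : E *m E = E -> \tr E = n%:R -> E = 1%:M.
Proof.
move=> EE trE; have [p [i [pi ip]]] := idem_factor EE.
have rE : \rank E = n.
  have lern := rank_leq_row E.
  have : (n - \rank E)%N%:R = 0 :> k.
    by rewrite natrB // -trE -[in \tr E]ip mxtrace_mulC pi mxtrace1 subrr.
  move/eqP; have /pcharf0P -> := char0; rewrite subn_eq0 => lenr.
  by apply/eqP; rewrite eqn_leq lern.
have uE : E \in unitmx by rewrite -row_full_unit /row_full rE.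
by rewrite -[E](mulmxK uE) EE mulmxV.
Qed.

Lemma simple_tsub (t : triple w) (M : dmod) a chi :
  is_simple_at M a chi -> a \in tK t ->
  {in tH t, forall h, chi h = tB t a h * chi 1%g} -> tsub t M.
Proof.
move=> [sM Ma0 [N [V [/row_freeP[D VD] VM MV chiE]]]] aK chiB.
have CH h : h \in tH t -> h \in 'C[a]%g by move=> hH;
  rewrite cent1_conjg (tKH_conjl aK hH).
(* Division by [B a] makes [T] an honest representation of [H]. Its averaging projector [E] has full
   trace by the hypothesis on [chi], so [E] is the identity and [T] is trivial; no eigenvalues are
   used. *)
have tactB h : h \in tH t -> tact N h = tB t a h *: 1%:M.
  move=> hH; pose T h := (tB t a h)^-1 *: tact N h.
  pose E := #|tH t|%:R^-1 *: \sum_(x in tH t) T x.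
  have H0 : #|tH t|%:R != 0 :> k by rewrite natr_neq0.
  have TT x y : x \in tH t -> y \in tH t -> T x *m T y = T (x * y)%g.
    move=> xH yH; rewrite /T -scalemxAl -scalemxAr tactM ?CH // !scalerA.
    have [-> // _] := tB_bichar t; congr (_ *: _).
    have := (tB_neq0 aK xH, tB_neq0 aK yH, beta_neq0 w a x y) => -[[b1 b2] b3].
    by field; rewrite b1 b2 b3.
  have TE x : x \in tH t -> T x *m E = E.
    move=> xH; rewrite -scalemxAr mulmx_sumr; congr (_ *: _).
    rewrite [RHS](reindex_inj (mulgI x)) /=.
    by apply: eq_big => [y|y yH]; rewrite ?groupMl // TT.
  have EE : E *m E = E.
    rewrite {1}/E -scalemxAl mulmx_suml (eq_bigr (fun=> E)) => [|x xH];
      last exact: TE.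
    by rewrite sumr_const -scaler_nat scalerA mulVf // scale1r.
  have trE : \tr E = (tdim N)%:R.
    rewrite mxtraceZ raddf_sum (eq_bigr (fun=> (tdim N)%:R)) => [|x xH].
      by rewrite sumr_const -(mulr_natl (tdim N)%:R) mulrA mulVf // mul1r.
    have := chiB x xH; rewrite chiE !ffunE group1 CH // tact1 mxtrace1 => trx.
    by rewrite /= mxtraceZ trx mulrA mulVf ?mul1r // tB_neq0.
  have E1 := idem_trace_full EE trE.
  have := TE h hH; rewrite E1 mulmx1 => /(congr1 ( *:%R (tB t a h))).
  by rewrite scalerA divff ?tB_neq0 // scale1r.
have MaB h : h \in tH t -> dact M a h = tB t a h *: dact M a 1%g.
  move=> hH.
  have /submxP[P /(congr1 trmx)] : ((dact M a 1%g)^T <= V^T)%MS by rewrite VM.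
  rewrite trmx_mul !trmxK => MVP.
  have -> : dact M a h = dact M a h *m dact M a 1%g.
    by rewrite -[LHS]dact_mul_id (tKH_conjl aK hH).
  by rewrite {1}MVP mulmxA MV ?CH // tactB // -scalemxAr mulmx1 -scalemxAl -MVP.
(* It is enough to test the identity on translates of the degree [a] part; there [tB_conj] carries
   the scalar from [a] to its conjugate [g']. *)
move=> g h hH; apply/eqP; rewrite -subr_eq0; apply/eqP.
apply: (simple_ext0 sM Ma0) => g' x.
have [E|ne] := eqVneq a (g' ^ x)%g; last first.
  by rewrite -mulmxA dactM (negPf ne) mulmx0.
have g'K : g' \in tK t by rewrite -(tK_conj t _ x) -E.
have fixg : (g' ^ h)%g = g' by rewrite (tKH_conjl g'K hH).
rewrite -mulmxA [in a in _ *m dact M a _]E dact_mul_id mulmxBl -scalemxAl.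
have [<-|ne] := eqVneq g' g; last first.
  rewrite !dactM conjg1 (negPf ne) scaler0 subr0.
  have [gK|gK] := boolP (g \in tK t); first by rewrite (tKH_conjl gK hH) (negPf ne).
  case: eqP => // gg; case/negP: gK; by rewrite -(tK_conj t _ h) -gg.
rewrite dact_id_mul.
have Eh := dact_mulE M g' h x; rewrite fixg in Eh.
have Ex := dact_mulE M g' x (h ^ x)%g.
rewrite -E MaB ?tH_conj // -scalemxAr [in dact M a _]E dact_mul_id -conjgC in Ex.
rewrite (tB_conj x g'K hH) -E.
rewrite Eh -(scalerA (beta g' h x / _)) Ex scalerA divfK ?beta_neq0 ?subrr //.
Qed.

Lemma tsub_scalar (t : triple w) (M : dmod) a chi h :
  tsub t M -> is_simple_at M a chi -> h \in tH t ->
  a \in tK t /\ chi h = tB t a h * chi 1%g.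
Proof.
move=> tM [_ Ma0 aff] hH.
have aK : a \in tK t.
  by apply: contraNT Ma0 => aK; rewrite (tsub_out _ tM aK).
split=> //; apply: (affords_scalar _ aff); last exact: tM.
by rewrite cent1_conjg (tKH_conjl aK hH).
Qed.

Lemma transversal_rep (R : {set gT}) g :
  is_transversal R (classes [set: gT]) [set: gT] -> exists x, (g ^ x)%g \in R.
Proof.
case/and3P=> _ _ /forall_inP/(_ (g ^: [set: gT])%g).
rewrite mem_classes ?inE // => /(_ isT)/cards1P[y E].
have : y \in R :&: (g ^: [set: gT])%g by rewrite E set11.
by case/setIP=> yR /imsetP[x _ Ey]; exists x; rewrite -Ey.
Qed.

Lemma dsimple_support (M : dmod) : dsimple M -> exists g, dact M g 1%g != 0.
Proof.
case=> M0 _; apply: contrapT => H; have := dact1 M.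
rewrite big1 => [/esym/eqP|g _]; last first.
  by apply/eqP; apply: contrapT => /negP ne; apply: H; exists g.
by rewrite -mxrank_eq0 mxrank1; case: (ddim M) M0.
Qed.

Lemma dsimple_affords (R : {set gT}) (M : dmod) g :
  is_transversal R (classes [set: gT]) [set: gT] ->
  dsimple M -> dact M g 1%g != 0 ->
  exists x chi, is_simple_at M (g ^ x)%g chi /\ in_Gamma w R (g ^ x)%g chi.
Proof.
move=> hR sM Mg; have [x gxR] := transversal_rep g hR.
have [|chi [sMa irr]] := @simple_affords _ _ _ M (g ^ x)%g sM.
  by rewrite dact_conj_eq0.
by exists x, chi.
Qed.

(** Complete reducibility reduces both directions to simple summands, whose degree can be conjugated
    into [R]. *)
Lemma subcat_SE (R : {set gT}) (t : triple w) (M : dmod) :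
  is_transversal R (classes [set: gT]) [set: gT] ->
  tsub t M <-> subcat_S R (tK t) (tH t) (tB t) M.
Proof.
move=> hR; split=> [tM | [n [F [sF iso]]]]; last first.
  apply: tsub_iso (diso_sym iso) _; apply: tsub_dsums => i.
  by have [a [chi [_ aK sFi chiB]]] := sF i; apply: simple_tsub sFi aK chiB.
have [n [F [sF iso]]] := semisimple char0 M.
exists n, F; split=> // i.
have tF := dsums_summand (@tsub_summand _ _ _ t) (tsub_iso iso tM) i.
have [g Fg] := dsimple_support (sF i).
have [x [chi [sFi G]]] := dsimple_affords hR (sF i) Fg.
exists (g ^ x)%g, chi; split=> // [|h hH].
  by have [] := tsub_scalar tF sFi (group1 _).
by have [] := tsub_scalar tF sFi hH.
Qed.

End SubcatS.

(** * The triple of a fusion subcategory *)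

Section TraceForm.
Variable k : fieldType.

Lemma mxtrace_mul_delta m n (A : 'M[k]_(m, n)) i j :
  \tr (A *m delta_mx j i) = A i j.
Proof.
rewrite /mxtrace (bigD1 i) //= big1 ?addr0 => [|l li].
  rewrite mxE (bigD1 j) //= big1 ?addr0 ?mxE ?eqxx ?mulr1 // => l lj.
  by rewrite mxE (negPf lj) mulr0.
by rewrite mxE big1 // => r _; rewrite mxE (negPf li) andbF mulr0.
Qed.

Lemma mxtrace_mul_inj m n (A B : 'M[k]_(m, n)) :
  (forall X, \tr (A *m X) = \tr (B *m X)) -> A = B.
Proof. by move=> E; apply/matrixP=> i j; rewrite -!mxtrace_mul_delta. Qed.

Lemma mxtrace_mul_neq0 m n (A : 'M[k]_(m, n)) :
  A != 0 -> exists X, \tr (A *m X) != 0.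
Proof.
move=> A0; apply: contrapT => H; case/eqP: A0; apply: mxtrace_mul_inj => X.
rewrite mul0mx mxtrace0; apply/eqP; apply: contrapT => /negP ne.
by apply: H; exists X.
Qed.

(** The trace is multiplicative on Kronecker products and the trace form is nondegenerate. *)
Lemma tprod_eq0 m1 n1 m2 n2 (A : 'M[k]_(m1, n1)) (B : 'M[k]_(m2, n2)) :
  tprod A B = 0 -> A = 0 \/ B = 0.
Proof.
move=> AB0; have [->|/mxtrace_mul_neq0[X AX]] := eqVneq A 0; [by left | right].
apply/eqP; apply: contrapT => /negP/mxtrace_mul_neq0[Y BY].
have := mxtrace_prod (A *m X) (B *m Y); rewrite tprodE AB0 mul0mx mxtrace0.
by move/esym/eqP; rewrite mulf_eq0 (negPf AX) (negPf BY).
Qed.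

Lemma scaler_injr m n (A : 'M[k]_(m, n)) a b : A != 0 -> a *: A = b *: A -> a = b.
Proof.
move=> A0 E; apply/eqP; rewrite -subr_eq0.
have /eqP : (a - b) *: A = 0 by rewrite scalerBl E subrr.
by rewrite scaler_eq0 (negPf A0) orbF.
Qed.

End TraceForm.

Section TripleOfSubcat.
Variables (gT : finGroupType) (k : fieldType) (w : cocycle3 gT k).
Local Notation beta := (beta w).
Local Notation gamma := (gamma w).
Local Notation dmod := (dmod w).

(** The idempotent of bidegree [(p, q)] cuts a single summand out of the coproduct. *)
Lemma dtensor_component (M N : dmod) p q x :
  tprod (dact M p 1%g) (dact N q 1%g) *m dact (dtensor M N) (p * q)%g x
  = gamma x p q *: tprod (dact M p x) (dact N q x).
Proof.
rewrite /= /dtensor_act mulmx_sumr (bigD1 (p, q)) //= big1 ?addr0 => [|[p' q']].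
  by rewrite -scalemxAr -tprodE !dact_id_mul.
case/andP=> _; rewrite xpair_eqE negb_and -scalemxAr -tprodE !dactM !conjg1 /=.
by case/orP=> /negPf->; rewrite ?tprod0l ?tprod0r scaler0.
Qed.

Variable D : fusion_subcat w.

(** Arbitrary objects and arbitrary degrees replace the simple objects at representatives;
    [subcat_KE] shows that the set is the same. *)
Definition supp_subcat : {set gT} :=
  [set g | `[< exists2 M, D M & dact M g 1%g != 0 >]].

(** Equality of actions replaces equality of character values; [subcat_HE] shows that the set is the
    same. *)
Definition ker_subcat : {set gT} :=
  [set h | `[< forall M, D M -> dact M 1%g h = dact M 1%g 1%g >]].

Lemma suppP g : reflect (exists2 M, D M & dact M g 1%g != 0) (g \in supp_subcat).
Proof. by rewrite inE; apply: asboolP. Qed.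

Lemma kerP h : reflect (forall M, D M -> dact M 1%g h = dact M 1%g 1%g)
  (h \in ker_subcat).
Proof. by rewrite inE; apply: asboolP. Qed.

Lemma supp_group_set : group_set supp_subcat.
Proof.
apply/group_setP; split=> [|p q].
  apply/suppP; exists (dunit w); first exact: fobj_unit.
  by rewrite /= /dunit_act eqxx -mxrank_eq0 mxrank1.
move=> /suppP[M DM Mp] /suppP[N DN Nq]; apply/suppP.
exists (dtensor M N); first exact: fobj_tensor.
apply/eqP => E; have := dtensor_component M N p q 1%g.
rewrite E mulmx0 gammag1 scale1r => /esym/tprod_eq0[] E0.
  by rewrite E0 eqxx in Mp.
by rewrite E0 eqxx in Nq.
Qed.

Lemma ker_mul h (M : dmod) x : h \in ker_subcat -> D M ->
  dact M 1%g (h * x)%g = dact M 1%g x.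
Proof.
move=> /kerP kh DM; have := dact_mulE M 1%g h x.
by rewrite conj1g beta1g scale1r kh // dact_id_mul.
Qed.

Lemma ker_group_set : group_set ker_subcat.
Proof.
apply/group_setP; split=> [|g h gK /kerP hK]; apply/kerP => // M DM.
by rewrite ker_mul // hK.
Qed.

Definition supp_group := Group supp_group_set.
Definition ker_group := Group ker_group_set.

Lemma supp_normal : (supp_group <| [set: gT])%g.
Proof.
rewrite /normal subsetT; apply/subsetP=> x _; rewrite inE.
apply/subsetP=> _ /imsetP[g /suppP[M DM Mg] ->]; apply/suppP; exists M => //.
by rewrite dact_conj_eq0.
Qed.

Lemma ker_normal : (ker_group <| [set: gT])%g.
Proof.
rewrite /normal subsetT; apply/subsetP=> x _; rewrite inE.
apply/subsetP=> _ /imsetP[h /kerP hK ->]; apply/kerP => M DM.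
have E y z : dact M 1%g y *m dact M 1%g z = dact M 1%g (y * z)%g.
  by have := dact_mulE M 1%g y z; rewrite conj1g beta1g scale1r.
by rewrite conjgE -!E hK // !E mul1g mulVg.
Qed.

Lemma supp_inv g : g \in supp_subcat -> exists2 M, D M & dact M g^-1%g 1%g != 0.
Proof. by move=> gK; apply/suppP; apply: (groupVr (G := supp_group)). Qed.

(* On the degree-1 part of M (x) N the element h acts trivially, so its actions
   on M_p and on N_{p^-1} are inverse to each other. *)
Lemma ker_tprod (M N : dmod) p q h : D M -> D N -> h \in ker_subcat ->
  (p * q = 1)%g ->
  gamma h p q *: tprod (dact M p h) (dact N q h)
  = tprod (dact M p 1%g) (dact N q 1%g).
Proof.
move=> DM DN /kerP hK pq.
have := dtensor_component M N p q 1%g; rewrite gammag1 scale1r => <-.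
rewrite -dtensor_component pq hK //; exact: fobj_tensor.
Qed.

Lemma supp_ker_fix g h : g \in supp_subcat -> h \in ker_subcat -> (g ^ h)%g = g.
Proof.
move=> gK hH; have [M DM Mg] := suppP _ gK; have [N DN Ng] := supp_inv gK.
apply/esym/eqP; apply: contraTT isT => ne.
have := ker_tprod DM DN hH (mulgV g).
(* If [g ^ h] differs from [g], then [delta_g hbar] times [delta_g ebar] is zero, which would
   annihilate a nonzero Kronecker product. *)
move=> /(congr1 (mulmx^~ (tprod (dact M g 1%g) (dact N g^-1%g 1%g)))).
rewrite -scalemxAl -!tprodE !dact_id_mul [dact M g h *m _]dactM (negPf ne).
rewrite tprod0l scaler0 => /esym/tprod_eq0[] E0.
  by rewrite E0 eqxx in Mg.
by rewrite E0 eqxx in Ng.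
Qed.

Lemma supp_ker_scalar g h : g \in supp_subcat -> h \in ker_subcat ->
  exists s, forall M, D M -> dact M g h = s *: dact M g 1%g.
Proof.
move=> gK hH; have [M0 DM0 M0g] := suppP _ gK; have [N DN Ng] := supp_inv gK.
have [Y vY] := mxtrace_mul_neq0 Ng.
(* Tracing [ker_tprod] against [tprod X Y] separates the two tensor factors. The factor [u] involves
   only the fixed module [N], so the resulting scalar is common to all objects [M]. *)
pose u := gamma h g g^-1 * \tr (dact N g^-1%g h *m Y).
have E (M : dmod) X : D M -> u * \tr (dact M g h *m X)
    = \tr (dact N g^-1%g 1%g *m Y) * \tr (dact M g 1%g *m X).
  move=> DM; have := ker_tprod DM DN hH (mulgV g).
  move=> /(congr1 (mulmx^~ (tprod X Y)))/(congr1 mxtrace).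
  rewrite -scalemxAl -!tprodE mxtraceZ !mxtrace_prod /u => E.
  by rewrite [RHS]mulrC -E; ring.
have u0 : u != 0.
  apply/eqP => u0; have [X MX] := mxtrace_mul_neq0 M0g.
  have /esym/eqP := E M0 X DM0; rewrite u0 mul0r mulf_eq0.
  by rewrite (negPf vY) (negPf MX).
exists (u^-1 * \tr (dact N g^-1%g 1%g *m Y)) => M DM.
apply: mxtrace_mul_inj => X; apply: (mulfI u0).
by rewrite E // -scalemxAl mxtraceZ !mulrA divff // mul1r.
Qed.

Lemma subcat_triple : exists t : triple w,
  [/\ tK t = supp_group, tH t = ker_group & forall M, D M -> tsub t M].
Proof.
pose good (q : gT * gT) (s : k) :=
  (s != 0) = (q.1 \in supp_subcat) && (q.2 \in ker_subcat) /\
  (q.1 \in supp_subcat -> q.2 \in ker_subcat ->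
   forall M, D M -> dact M q.1 q.2 = s *: dact M q.1 1%g).
have /choice[b bP] : forall q, exists s, good q s.
  move=> [g h]; rewrite /good /=.
  have [gK|gK] := boolP (g \in supp_subcat); last by exists 0; rewrite eqxx.
  have [hH|hH] := boolP (h \in ker_subcat); last by exists 0; rewrite eqxx.
  have [s sP] := supp_ker_scalar gK hH; exists s; split=> //.
  have [M DM Mg] := suppP _ gK; apply/eqP => s0.
  have := sP M DM; rewrite s0 scale0r => /eqP.
  by rewrite dact_eq0 (negPf Mg).
pose B g h := b (g, h).
have Bsupp g h : (B g h != 0) = (g \in supp_group) && (h \in ker_group).
  by have [] := bP (g, h).
have BE g h M : g \in supp_group -> h \in ker_group -> D M ->
    dact M g h = B g h *: dact M g 1%g.
  by move=> gK hH DM; have [_ ] := bP (g, h); apply.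
have comm g h : g \in supp_group -> h \in ker_group -> (g * h = h * g)%g.
  by move=> gK hH; rewrite conjgC supp_ker_fix.
(* Each law compares two scalars on a nonzero space: a degree part of one object for the second
   variable, a bidegree part of a tensor product of two objects for the first. *)
have bichar : omega_bicharacter w supp_group ker_group B.
  split; [move=> g x y gK xH yH | move=> p q h pK qK hH].
    have [M DM Mg] := suppP _ gK; apply: (scaler_injr Mg).
    rewrite -BE ?groupM //.
    apply: (scalerI (beta_neq0 w g x y));
      rewrite scalerA !mulrA divff ?beta_neq0 //.
    rewrite mul1r -dact_mulE supp_ker_fix // (BE _ _ _ gK xH DM) -scalemxAl.
    by rewrite dact_id_mul (BE _ _ _ gK yH DM) scalerA.
  have [M DM Mp] := suppP _ pK; have [N DN Nq] := suppP _ qK.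
  have T0 : tprod (dact M p 1%g) (dact N q 1%g) != 0.
    by apply/eqP=> /tprod_eq0[] E; [move: Mp | move: Nq]; rewrite E eqxx.
  apply: (scaler_injr T0).
  have := dtensor_component M N p q 1%g; rewrite gammag1 scale1r => {1}<-.
  rewrite scalemxAr -(BE _ _ _ (groupM pK qK) hH (fobj_tensor DM DN)).
  rewrite dtensor_component (BE _ _ _ pK hH DM) (BE _ _ _ qK hH DN) tprodZ.
  by rewrite scalerA mulrA gamma_commE ?supp_ker_fix.
have inv : G_invariant w supp_group ker_group B.
  move=> x a h aK hH; have [M DM Ma] := suppP _ aK; rewrite -mulgA -conjgE.
  have axK : (a ^ x)%g \in supp_group.
    by rewrite memJ_norm // (subsetP (normal_norm supp_normal)) ?inE.
  have hxH : (x * h * x^-1)%g \in ker_group.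
    rewrite -mulgA -[x in (x * _)%g]invgK -conjgE memJ_norm //.
    by rewrite (subsetP (normal_norm ker_normal)) ?inE.
  have axh : (a ^ (x * h))%g = (a ^ x)%g by rewrite conjgM (supp_ker_fix axK hH).
  (* The same triple product is computed twice: with the middle factor as a scalar, and by
     multiplying the group elements from the left. *)
  have E1 : dact M a x *m dact M (a ^ x)%g h *m dact M (a ^ x)%g x^-1%g
      = (B (a ^ x)%g h * beta a x x^-1) *: dact M a 1%g.
    by rewrite (BE _ _ _ axK hH DM) -scalemxAr dact_mul_id -scalemxAl dact_mulV
      scalerA.
  have E2 : dact M a x *m dact M (a ^ x)%g h *m dact M (a ^ x)%g x^-1%g
      = (beta a x h * beta a (x * h) x^-1 * B a (x * h * x^-1)%g) *: dact M a 1%g.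
    rewrite dact_mulE -scalemxAl -axh dact_mulE (BE _ _ _ aK hxH DM).
    by rewrite !scalerA mulrA.
  have := scaler_injr Ma (etrans (esym E1) E2) => EB.
  apply: (mulIf (beta_neq0 w a x x^-1%g)); rewrite EB [RHS]mulrAC divfK //.
  exact: beta_neq0.
exists (Triple supp_normal ker_normal comm Bsupp bichar inv);
  split=> // M DM g h hH /=.
have [gK|gK] := boolP (g \in supp_group); first exact: BE.
have Mg : dact M g 1%g = 0.
  by apply/eqP; apply: contraNT gK => Mg; apply/suppP; exists M.
by rewrite Mg scaler0; apply/eqP; rewrite dact_eq0 Mg.
Qed.

End TripleOfSubcat.

(** * Matrix coefficients *)

Section Coefficients.
Variables (gT : finGroupType) (k : fieldType) (w : cocycle3 gT k).
Hypothesis char0 : [pchar k] =i pred0.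
Local Notation beta := (beta w).
Local Notation gamma := (gamma w).
Local Notation dmod := (dmod w).

Lemma gammax1 x g : gamma x g 1%g = 1.
Proof. by rewrite /gamma conj1g !cocycg1 cocyc_norm invr1 !mulr1. Qed.

Lemma diso_dsum0 (M : dmod) : diso (dsum M (dzero w)) M.
Proof.
apply: (@dhom_diso _ _ _ (dsum M (dzero w)) M (row_mx 1%:M 0) (col_mx 1%:M 0)).
- by move=> g x; rewrite mul_row_block !mulmx0 !addr0 mul1mx mul_mx_row mulmx1
    mulmx0.
- by rewrite mul_row_col mulmx1 mulmx0 addr0.
- rewrite mul_col_row mulmx1 !mulmx0 mul0mx [RHS]scalar_mx_block.
  by congr block_mx; rewrite [RHS]flatmx0.
Qed.

(** The closure condition on families of length 2 produces [M] plus ([N] plus zero), whence the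
    final isomorphism. *)
Lemma fobj_dsum (D : fusion_subcat w) (M N : dmod) : D M -> D N -> D (dsum M N).
Proof.
move=> DM DN.
have : D (dsums (fun i : 'I_2 => if unlift ord0 i is Some _ then N else M)).
  by apply: fobj_sums => i; case: unliftP.
rewrite (dsums_cons M (fun _ : 'I_1 => N)) /dsums big_ord_recl big_ord0.
by apply: fobj_iso; apply/diso_dsumr/diso_dsum0.
Qed.

Variable D : fusion_subcat w.

Definition coef (f : gT -> gT -> k) : Prop :=
  exists (W : dmod) (A : 'M_(ddim W)), D W /\ forall g x, f g x = \tr (A *m
    dact W g x).

Definition coef1 (u : gT -> k) : Prop := coef (fun g x => (g == 1%g)%:R * u x).

Lemma eq_coef f f' : (forall g x, f g x = f' g x) -> coef f -> coef f'.
Proof. by move=> E [W [A [DW fE]]]; exists W, A; split=> // g x; rewrite -E. Qed.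

Lemma eq_coef1 u v : u =1 v -> coef1 u -> coef1 v.
Proof. by move=> E; apply: eq_coef => g x; rewrite E. Qed.

Lemma coefZ c f : coef f -> coef (fun g x => c * f g x).
Proof.
move=> [W [A [DW fE]]]; exists W, (c *: A); split=> // g x.
by rewrite fE -scalemxAl mxtraceZ.
Qed.

Lemma coefD f f' : coef f -> coef f' -> coef (fun g x => f g x + f' g x).
Proof.
move=> [W [A [DW fE]]] [W' [A' [DW' fE']]].
exists (dsum W W'), (block_mx A 0 0 A'); split=> [|g x]; first exact: fobj_dsum.
rewrite fE fE' /= /dsum_act mulmx_block !mul0mx !mulmx0 !addr0 !add0r.
by rewrite mxtrace_block.
Qed.

Lemma coef0 : coef (fun _ _ => 0).
Proof.
exists (dunit w), 0; split=> [|g x]; first exact: fobj_unit.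
by rewrite mul0mx mxtrace0.
Qed.

Lemma coef_sum (I : finType) (P : pred I) (f : I -> gT -> gT -> k) :
  (forall i, P i -> coef (f i)) -> coef (fun g x => \sum_(i | P i) f i g x).
Proof.
move=> cf; elim: (index_enum I) => [|i s IH].
  by apply: eq_coef coef0 => g x; rewrite big_nil.
have [Pi|nPi] := boolP (P i).
  by apply: eq_coef (coefD (cf i Pi) IH) => g x; rewrite big_cons Pi.
by apply: eq_coef IH => g x; rewrite big_cons (negPf nPi).
Qed.

Lemma coef_restr (W : dmod) (A : 'M_(ddim W)) a : D W ->
  coef (fun g x => (g == a)%:R * \tr (A *m dact W a x)).
Proof.
move=> DW; exists W, (A *m dact W a 1%g); split=> // g x.
rewrite -mulmxA dactM conjg1; have [_|_] := eqVneq g a.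
  by rewrite betag1l scale1r !mul1r mul1g.
by rewrite mul0r mulmx0 mxtrace0.
Qed.

(* The convolution of f with a function supported in degree 1. *)
Lemma coefM1 f v : coef f -> coef1 v -> coef (fun g x => f g x * v x).
Proof.
move=> [W [A [DW fE]]] [V [C [DV vE]]].
exists (dtensor W V), (tprod A C); split=> [|g x]; first exact: fobj_tensor.
rewrite /= /dtensor_act mulmx_sumr raddf_sum /= (bigD1 (g, 1%g)) /=;
  last by rewrite mulg1.
rewrite big1 ?addr0 => [|[p q] /= /andP[/eqP <- ne]].
  by rewrite -scalemxAr mxtraceZ -tprodE mxtrace_prod -vE -fE gammax1 eqxx !mul1r.
rewrite -scalemxAr mxtraceZ -tprodE mxtrace_prod -vE.
have [q1|_] := eqVneq q 1%g; last by rewrite mul0r !mulr0.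
by rewrite q1 mulg1 eqxx in ne.
Qed.

Lemma coef1M u v : coef1 u -> coef1 v -> coef1 (fun x => u x * v x).
Proof.
by move=> cu cv; apply: eq_coef (coefM1 cu cv) => g x; rewrite mulrA.
Qed.

Lemma coef1_one : coef1 (fun=> 1).
Proof.
exists (dunit w), 1%:M; split=> [|g x]; first exact: fobj_unit.
by rewrite mul1mx /= /dunit_act mxtrace_scalar mulr1 mulr1n.
Qed.

Lemma coef1_comb c d u v : coef1 u -> coef1 v -> coef1 (fun x => c * u x + d * v x).
Proof.
move=> cu cv; apply: eq_coef (coefD (coefZ c cu) (coefZ d cv)) => g x.
by ring.
Qed.

Lemma coef1_trans u y : coef1 u -> coef1 (fun x => u (y * x)%g).
Proof.
move=> [W [A [DW uE]]]; exists W, (A *m dact W 1%g y); split=> // g x.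
rewrite -mulmxA dactM conj1g; case: eqP => _; last by rewrite mul0r mulmx0 mxtrace0.
by rewrite beta1g scale1r -uE eqxx.
Qed.

Lemma coef1_prod (I : finType) (P : pred I) (u : I -> gT -> k) :
  (forall i, coef1 (u i)) -> coef1 (fun x => \prod_(i | P i) u i x).
Proof.
move=> cu; elim: (index_enum I) => [|i s IH].
  by apply: eq_coef1 coef1_one => x; rewrite big_nil.
have [Pi|nPi] := boolP (P i).
  by apply: eq_coef1 (coef1M (cu i) IH) => x; rewrite big_cons Pi.
by apply: eq_coef1 IH => x; rewrite big_cons (negPf nPi).
Qed.

Local Notation K := (supp_group D).
Local Notation H := (ker_group D).

(* Stone-Weierstrass: the functions coef1 form an algebra separating the cosets
   of H. *)
Lemma coef1_ker : coef1 (fun x => (x \in H)%:R).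
Proof.
(* For [z] outside [H], some coefficient differs at [z] and at 1; an affine change makes it 1 on [H]
   and 0 at [z]. The product over all such [z] is the indicator of [H]. *)
have /choice[v vP] : forall z, exists v, [/\ coef1 v, {in H, forall h, v h = 1}
    & z \notin H -> v z = 0].
  move=> z; have [zH|zH] := boolP (z \in H).
    by exists (fun=> 1); split=> //; apply: coef1_one.
  have [M DM Mz] : exists2 M, D M & dact M 1%g z != dact M 1%g 1%g.
    apply: contrapT => nM; case/negP: zH; apply/kerP => M DM.
    by apply/eqP; apply: contrapT => /negP ne; apply: nM; exists M.
  have [|X X0] := @mxtrace_mul_neq0 _ _ _ (dact M 1%g 1%g - dact M 1%g z).
    by rewrite subr_eq0 eq_sym.
  pose u x := \tr (X *m dact M 1%g x).
  have cu : coef1 u by apply: coef_restr.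
  have d0 : u 1%g - u z != 0 by rewrite /u !(mxtrace_mulC X) -raddfB -mulmxBl.
  pose d := u 1%g - u z.
  exists (fun x => d^-1 * u x + (- (u z / d)) * 1); split=> [|h hH|_].
  - by apply: coef1_comb => //; apply: coef1_one.
  - have -> : u h = u 1%g by rewrite /u (kerP _ _ hH).
    by rewrite mulr1 mulrC -mulrBl divff.
  - by rewrite mulr1 mulrC subrr.
have cv z : coef1 (v z) by case: (vP z).
apply: eq_coef1 (coef1_prod (fun z => z \notin H) cv) => x.
have [xH|xH] := boolP (x \in H).
  by rewrite big1 // => z _; have [_ vz _] := vP z; apply: vz.
by rewrite (bigD1 x) //=; have [_ _ ->] := vP x; rewrite ?mul0r.
Qed.

Lemma tsub_coef (t : triple w) (M : dmod) (A : 'M_(ddim M)) :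
  tK t = K -> tH t = H -> (forall N, D N -> tsub t N) -> tsub t M ->
  coef (fun g x => \tr (A *m dact M g x)).
Proof.
move=> tKE tHE tD tM.
(* On the coset [y H], [F g y g x] is the ratio of [delta_g xbar] to [delta_g ybar] in every module
   satisfying [tsub t]. Objects of [D] and [M] thus share it, and any object of [D] nonzero in
   degree [g] realizes it as a coefficient. *)
pose F g y g' x := (g' == g)%:R * ((y^-1 * x)%g \in H)%:R
   * ((beta g y (y^-1 * x))^-1 * tB t (g ^ y)%g (y^-1 * x)%g).
have cF g y : g \in K -> coef (F g y).
  move=> /suppP[N DN Ng].
  have /mxtrace_mul_neq0[C C0] : dact N g y != 0 by rewrite dact_eq0.
  have := coefZ (\tr (dact N g y *m C))^-1
    (coefM1 (coef_restr C g DN) (coef1_trans y^-1 coef1_ker)).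
  apply: eq_coef => g' x; rewrite /F; have [_|_] := eqVneq g' g;
    last by rewrite !mul0r mulr0.
  have [yxH|] := boolP (_ \in H); last by rewrite !mulr0 mul0r.
  rewrite !mul1r mulr1; have := dact_mulE N g y (y^-1 * x)%g; rewrite mulKVg.
  rewrite (tD N DN (g ^ y)%g) ?tHE // -scalemxAr dact_mul_id => /(congr1 (fun Z
    => \tr (C *m Z))).
  rewrite -!scalemxAr !mxtraceZ [\tr (C *m dact N g y)]mxtrace_mulC => E.
  apply: (mulfI (beta_neq0 w g y (y^-1 * x)%g)); rewrite mulrCA -E.
  rewrite [RHS]mulrA divff ?beta_neq0 // mul1r mulrCA mulVf ?mulr1 //.
have H0 : #|H|%:R != 0 :> k by rewrite natr_neq0.
(* Each [x] is reached from the [#|H|] elements [y] of its coset, which explains the weight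
   [#|H|^-1]. *)
apply: (eq_coef (f := fun g' x => \sum_(g in K) \sum_y
    (#|H|%:R^-1 * \tr (A *m dact M g y)) * F g y g' x)); last first.
  apply: coef_sum => g gK; apply: coef_sum => y _; apply: coefZ; exact: cF.
move=> g' x; have [g'K|g'K] := boolP (g' \in K); last first.
  rewrite (tsub_out _ tM) ?tKE // mulmx0 mxtrace0 big1 // => g gK.
  rewrite big1 // => y _; rewrite /F; have [E|_] := eqVneq g' g;
    last by rewrite !mul0r mulr0.
  by rewrite E gK in g'K.
rewrite (bigD1 g') //= [X in _ + X]big1 ?addr0 => [|g /andP[_ ne]]; last first.
  by rewrite big1 // => y _; rewrite /F eq_sym (negPf ne) !mul0r mulr0.
transitivity (\sum_(z in H) #|H|%:R^-1 * \tr (A *m dact M g' x)); last first.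
  by rewrite sumr_const -(mulr_natl (_ * _)) mulrA divff // mul1r.
rewrite (reindex_inj (h := fun z => (x * z^-1)%g)) /=; last first.
  by move=> y z /mulgI/invg_inj.
rewrite [RHS]big_mkcond; apply: eq_bigr => z _.
rewrite /F eqxx mul1r invMg invgK mulgKV; case: ifP => zH;
  last by rewrite mul0r mulr0.
rewrite mul1r -mulrA; congr (_ * _).
have := dact_mulE M g' (x * z^-1)%g z; rewrite mulgKV.
rewrite (tM (g' ^ _)%g) ?tHE // -scalemxAr dact_mul_id => /(congr1 (fun Z =>
  \tr (A *m Z))).
rewrite -!scalemxAr !mxtraceZ => E.
by rewrite mulrC -mulrA E mulrA mulVf ?mul1r // beta_neq0.
Qed.

(** Schur orthogonality: if [M] is not in [D], every average of a map from an object of [D] to [M]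
    vanishes, so the coefficients of [M] pair to zero with those of [D]. Pairing them with
    themselves gives the nonzero group order. *)
Lemma coef_mem (M : dmod) : dsimple M ->
  (forall A : 'M_(ddim M), coef (fun g x => \tr (A *m dact M g x))) -> D M.
Proof.
move=> sM cM; apply: contrapT => nDM.
have avg0 (W : dmod) (f : 'M_(ddim M, ddim W)) : D W -> davg f = 0.
  move=> DW; apply/eqP; apply: contrapT => /negP f0; apply: nDM.
  have [s [hs fs]] := dhom_simple_section char0 sM (@davg_hom _ _ _ W M f) f0.
  exact: retract_fobj (@davg_hom _ _ _ W M f) hs fs DW.
(* Averages of the elementary matrices [delta_mx i l] have as entries the pairings of the [(j, i)]
   coefficient of [M] with the coefficients of [W]. *)
have E i j f : coef f ->
    \sum_g \sum_x (beta g x x^-1)^-1 * (dact M g x j i * f (g ^ x)%g x^-1%g) = 0.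
  move=> [W [A [DW fE]]].
  transitivity (\tr (A *m \matrix_(l, m) davg (M := W) (N := M) (delta_mx i l)
    j m)).
    have -> : \matrix_(l, m) davg (M := W) (N := M) (delta_mx i l) j m
        = \sum_g \sum_x (beta g x x^-1)^-1 *: (dact M g x j i *: dact W (g ^
          x)%g x^-1%g).
      apply/matrixP=> l m; rewrite mxE /davg !summxE; apply: eq_bigr => g _.
      rewrite !summxE; apply: eq_bigr => x _; rewrite !mxE; congr (_ * _).
      rewrite (bigD1 l) //= big1 ?addr0 => [|m' ne].
        rewrite mxE (bigD1 i) //= big1 ?addr0 ?mxE ?eqxx ?mulr1 // => i' ne.
        by rewrite mxE (negPf ne) mulr0.
      rewrite mxE big1 ?mul0r // => i' _.
      by rewrite mxE (negPf ne) andbF mulr0.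
    rewrite mulmx_sumr raddf_sum; apply: eq_bigr => g _.
    rewrite mulmx_sumr raddf_sum; apply: eq_bigr => x _.
    by rewrite -!scalemxAr /= !mxtraceZ fE.
  rewrite (_ : \matrix_(l, m) _ = 0) ?mulmx0 ?mxtrace0 //.
  by apply/matrixP=> l m; rewrite mxE avg0 // !mxE.
have [M0 _] := sM; pose j := Ordinal M0.
have := davg_id M => /matrixP/(_ j j); rewrite [RHS]mxE eqxx mulr1n => /esym/eqP.
apply/negP; rewrite (_ : davg _ j j = 0) ?card_neq0 //.
(* Summing over [i] the pairings with the coefficients of [M] itself rebuilds a diagonal entry of
   the average of the identity. *)
transitivity (\sum_i \sum_g \sum_x (beta g x x^-1)^-1 *
   (dact M g x j i * \tr (delta_mx j i *m dact M (g ^ x)%g x^-1%g))); last first.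
  by rewrite big1 // => i _; apply: E (cM _).
rewrite exchange_big /davg summxE; apply: eq_bigr => g _ /=.
rewrite exchange_big summxE; apply: eq_bigr => x _ /=.
rewrite -mulr_sumr mxE mulmx1 mxE; congr (_ * _); apply: eq_bigr => i _.
by rewrite mxtrace_mulC mxtrace_mul_delta.
Qed.

Lemma tsub_fobj (t : triple w) (M : dmod) :
  tK t = K -> tH t = H -> (forall N, D N -> tsub t N) -> tsub t M -> D M.
Proof.
move=> tKE tHE tD tM; have [n [F [sF iso]]] := semisimple char0 M.
apply: fobj_iso (diso_sym iso) _; apply: fobj_sums => i.
apply: coef_mem => // A; apply: tsub_coef tKE tHE tD _.
exact: (dsums_summand (@tsub_summand _ _ _ t) (tsub_iso iso tM)).
Qed.

End Coefficients.

(** * Characters in degree 1 *)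

Section SubcatTriple.
Variables (gT : finGroupType) (k : closedFieldType) (w : cocycle3 gT k).
Hypothesis char0 : [pchar k] =i pred0.
Variable R : {set gT}.
Hypothesis hR : is_transversal R (classes [set: gT]) [set: gT].
Local Notation dmod := (dmod w).

Lemma affords_trace (M : dmod) a chi x :
  affords M a chi -> x \in 'C[a]%g -> chi x = \tr (dact M a x).
Proof.
move=> [N [V [/row_freeP[D VD] VM MV ->]]] Cx; rewrite ffunE Cx.
have /submxP[P /(congr1 trmx)] : ((dact M a 1%g)^T <= V^T)%MS by rewrite VM.
rewrite trmx_mul !trmxK => MVP.
have DV : D^T *m V = 1%:M by rewrite -[V]trmxK -trmx_mul VD trmx1.
have PV : P^T *m V = 1%:M.
  have := MV 1%g (group1 _); rewrite tact1 mulmx1 MVP => /(congr1 (mulmx D^T)).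
  by rewrite !mulmxA DV mul1mx.
have -> : dact M a x = V *m tact N x *m P^T.
  have := dact_mul_id M a x; move: Cx; rewrite cent1_conjg => /eqP ax.
  by rewrite ax MVP mulmxA MV // cent1_conjg ax.
by rewrite mxtrace_mulC mulmxA PV mul1mx.
Qed.

Variable D : fusion_subcat w.

(** A nonzero degree part of an object is already nonzero in one of its simple summands, and that
    degree can be conjugated into [R]. *)
Lemma subcat_KE : subcat_K R D = supp_subcat D.
Proof.
apply/setP=> g; rewrite [LHS]inE; apply/asboolP/suppP.
  move=> [x [a [chi [[_ [M [_ Ma _] DM]] ->]]]]; exists M => //.
  by rewrite -mulgA -[x in (x * _)%g]invgK -conjgE dact_conj_eq0.
move=> [M DM Mg]; have [n [F [sF iso]]] := semisimple char0 M.
have [i Fig] : exists i, dact (F i) g 1%g != 0.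
  apply: contrapT => H; case/eqP: Mg; have [f [s [hf _ _ sf]]] := diso_inv iso.
  rewrite -[LHS]mul1mx -sf -mulmxA hf.
  suff -> : dact (dsums F) g 1%g = 0 by rewrite mul0mx mulmx0.
  rewrite /dsums; elim/big_ind: _ => [//|M1 M2 E1 E2|i _].
    by rewrite /= /dsum_act E1 E2 block_mx0.
  by apply/eqP; apply: contrapT => /negP ne; apply: H; exists i.
have DF := dsums_summand (@fobj_summand _ _ _ D) (fobj_iso iso DM) i.
have [x [chi [sFi G]]] := dsimple_affords hR (sF i) Fig.
exists x, (g ^ x)%g, chi; split; first by split=> //; exists (F i).
by rewrite conjgE !mulgA mulgV mul1g mulgK.
Qed.

(* Averaging over conjugates turns A, by Schur's lemma, into a scalar on each
   simple summand, so that only values of characters at h remain; this avoids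
   roots of unity. *)
Lemma subcat_H_sum h (M : dmod) (A : 'M_(ddim M)) : h \in subcat_H R D -> D M ->
  \sum_x \tr (A *m dact M 1%g (h ^ x)%g) = \sum_(x : gT) \tr (A *m dact M 1%g 1%g).
Proof.
rewrite inE => /asboolP hH DM.
pose Q (W : dmod) := forall A : 'M_(ddim W),
  \sum_x \tr (A *m dact W 1%g (h ^ x)%g) = \sum_(x : gT) \tr (A *m dact W 1%g 1%g).
have R1 : 1%g \in R by have [x] := transversal_rep 1%g hR; rewrite conj1g.
have Qsimple W : dsimple W -> D W -> Q W.
  move=> sW DW C; have [W0|W0] := eqVneq (dact W 1%g 1%g) 0.
    by apply: eq_bigr => x _; rewrite -[dact W _ (_ ^ _)%g]dact_id_mul W0 mul0mx.
  have [chi [sWchi irr]] := simple_affords sW W0.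
  have chih : chi h = chi 1%g.
    by apply: hH; split; [split | exists W].
  have [_ _ aff] := sWchi.
  have C1 x : x \in 'C[1%g]%g by rewrite cent1_conjg conj1g.
  have trh : \tr (dact W 1%g h) = \tr (dact W 1%g 1%g).
    by rewrite -!(affords_trace aff).
  have E x y : dact W 1%g x *m dact W 1%g y = dact W 1%g (x * y)%g.
    by have := dact_mulE W 1%g x y; rewrite conj1g beta1g scale1r.
  (* Only the degree 1 terms of the average survive, and cyclicity of the trace moves the
     conjugation from [C] to [y]. *)
  have avgE y : \tr (davg (M := W) (N := W) C *m dact W 1%g y)
      = \sum_x \tr (C *m dact W 1%g (y ^ x)%g).
    rewrite /davg mulmx_suml raddf_sum (bigD1 1%g) //= [X in _ + X]big1 ?addr0
      => [|g ne].
      rewrite mulmx_suml raddf_sum; apply: eq_bigr => x _.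
      rewrite /= beta1g invr1 scale1r conj1g -!mulmxA mxtrace_mulC -!mulmxA !E.
      by rewrite conjgE.
    rewrite mulmx_suml raddf_sum big1 //= => x _.
    rewrite -scalemxAl -!mulmxA dactM conjgK eq_sym (negPf ne).
    by rewrite !mulmx0 scaler0 mxtrace0.
  transitivity (\sum_x \tr (C *m dact W 1%g (1 ^ x)%g)); last first.
    by apply: eq_bigr => x _; rewrite conj1g.
  rewrite -!avgE; have [c ->] := schur char0 sW (davg_hom (M := W) (N := W) C).
  by rewrite !mul_scalar_mx !mxtraceZ trh.
have Qsum (W1 W2 : dmod) : Q W1 -> Q W2 -> Q (dsum W1 W2).
  move=> Q1 Q2 C; rewrite -[C]submxK.
  have E y : \tr (block_mx (ulsubmx C) (ursubmx C) (dlsubmx C) (drsubmx C)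
        *m dact (dsum W1 W2) 1%g y)
      = \tr (ulsubmx C *m dact W1 1%g y) + \tr (drsubmx C *m dact W2 1%g y).
    by rewrite /= /dsum_act mulmx_block !mulmx0 !addr0 !add0r mxtrace_block.
  by rewrite (eq_bigr _ (fun x _ => E _)) [RHS](eq_bigr _ (fun x _ => E _))
    !big_split /= Q1 Q2.
have Q0 : Q (dzero w).
  by move=> C; apply: eq_bigr.
have [n [F [sF iso]]] := semisimple char0 M.
have QF : Q (dsums F).
  rewrite /dsums; elim/big_ind: _ => // i _; apply: Qsimple => //.
  exact: (dsums_summand (@fobj_summand _ _ _ D) (fobj_iso iso DM)).
have [f [s [hf _ _ sf]]] := diso_inv iso.
have E y : \tr (A *m dact M 1%g y) = \tr (f *m A *m s *m dact (dsums F) 1%g y).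
  by rewrite -!mulmxA [RHS]mxtrace_mulC -!mulmxA -hf (mulmxA s) sf mul1mx.
by rewrite (eq_bigr _ (fun x _ => E _)) [RHS](eq_bigr _ (fun x _ => E _)) QF.
Qed.

Lemma subcat_HE : subcat_H R D = ker_subcat D.
Proof.
apply/setP=> h; apply/idP/idP => [hH|/kerP hK]; last first.
  rewrite inE; apply/asboolP => chi [_ [M [_ _ aff] DM]].
  rewrite (affords_scalar (c := 1) _ aff) ?mul1r //.
    by rewrite cent1_conjg conj1g.
  by rewrite scale1r hK.
(* The indicator of the kernel is itself a coefficient and is constant on conjugacy classes, so the
   averaged identity says that its value at [h] equals its value at 1. *)
have [W [A [DW fE]]] := coef1_ker D.
have := subcat_H_sum A hH DW.
rewrite (eq_bigr (fun=> (h \in ker_group D)%:R)) => [|x _]; last first.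
  rewrite -fE eqxx mul1r memJ_norm //.
  by rewrite (subsetP (normal_norm (ker_normal D))) ?inE.
rewrite [RHS](eq_bigr (fun=> 1)) => [|x _]; last by rewrite -fE eqxx mul1r group1.
rewrite !sumr_const; case: (boolP (h \in ker_group D)) => // _.
by rewrite mul0rn => /esym/eqP; rewrite (negPf (card_neq0 _ char0)).
Qed.

Lemma triple_of_tsub (t : triple w) :
  tK t = supp_group D -> tH t = ker_group D -> (forall M, D M -> tsub t M) ->
  triple_of R D t.
Proof.
move=> tKE tHE tD; split; rewrite ?subcat_KE ?subcat_HE ?tKE ?tHE //.
move=> a chi x h [_ [M sMa DM]]; rewrite subcat_HE => hH.
have hHt : h \in tH t by rewrite tHE.
have chi0 := affords_dim char0 sMa.
have xhH : (x * h * x^-1)%g \in tH t.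
  by rewrite -mulgA -[x in (x * _)%g]invgK -conjgE tH_conj.
have [aK chiE] := tsub_scalar (tD M DM) sMa xhH.
by rewrite (tB_inv x aK hHt) chiE mulfK.
Qed.

(** Every element of [K] is conjugate to the degree of a simple object of [D], where the formula
    fixes [B]; elsewhere [tB_supp] makes [B] zero. *)
Lemma triple_of_inj (t t' : triple w) : triple_of R D t -> triple_of R D t' ->
  t = t'.
Proof.
move=> [tKE tHE tBE] [tKE' tHE' tBE'].
have eK : tK t = tK t' by apply/val_inj; rewrite /= tKE tKE'.
have eH : tH t = tH t' by apply/val_inj; rewrite /= tHE tHE'.
have eB : tB t = tB t'.
  apply/funext => g; apply/funext => h.
  have [gK|gK] := boolP (g \in tK t); last by rewrite !tB_out -?eK.
  have [hH|hH] := boolP (h \in tH t); last first.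
    transitivity (0 : k); [|symmetry]; apply/eqP; rewrite -[_ == _]negbK tB_supp.
      by rewrite (negPf hH) andbF.
    by rewrite -eH (negPf hH) andbF.
  move: gK hH; rewrite tKE tHE => /[1!inE]/asboolP[x [a [chi [inD gE]]]] hH.
  have {gE}-> : g = (x^-1^-1 * a * x^-1)%g by rewrite invgK.
  by rewrite (tBE _ _ _ _ inD) ?(tBE' _ _ _ _ inD).
case: t t' eK eH eB {tKE tHE tBE tKE' tHE' tBE'} => K H B n1 n2 c s b i [K' H'
  B' n1' n2' c' s' b' i'] /= eK eH eB.
by subst K' H' B'; congr Triple; apply: Prop_irrelevance.
Qed.

End SubcatTriple.

(** * The regular module *)

Section RegularModule.
Variables (gT : finGroupType) (k : fieldType) (w : cocycle3 gT k).
Local Notation beta := (beta w).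
Local Notation dmod := (dmod w).

Definition finmx (T : finType) (f : T -> T -> k) : 'M[k]_#|T| :=
  \matrix_(i, j) f (enum_val i) (enum_val j).

Lemma finmxM (T : finType) (f f' : T -> T -> k) :
  finmx f *m finmx f' = finmx (fun p r => \sum_q f p q * f' q r).
Proof.
apply/matrixP=> i j; rewrite !mxE [RHS]big_enum_val.
by apply: eq_bigr => l _; rewrite !mxE.
Qed.

(* Left multiplication in the basis delta_h ybar, indexed by the pairs (h, y). *)
Definition reg_act (g x : gT) : 'M[k]_#|{: gT * gT}| :=
  finmx (fun p r : gT * gT =>
    [&& p.1 == g, p.2 == (x * r.2)%g & r.1 == (g ^ x)%g]%:R * beta g x r.2).

Fact reg_actM g x h y :
  reg_act g x *m reg_act h y
  = if h == (g ^ x)%g then beta g x y *: reg_act g (x * y)%g else 0.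
Proof.
rewrite finmxM; apply/matrixP=> i j; rewrite mxE.
transitivity ((if h == (g ^ x)%g then beta g x y else 0) *
    reg_act g (x * y)%g i j); last first.
  by case: ifP => _; rewrite !mxE ?mul0r.
rewrite mxE; move: (enum_val i) (enum_val j) => -[p1 p2] [r1 r2] /=.
rewrite (bigD1 ((g ^ x)%g, (y * r2)%g)) //= big1 ?addr0 => [|[q1 q2] ne].
  rewrite !eqxx /= andbT -mulgA [_ == h]eq_sym; case: (h =P (g ^ x)%g) => [->|_];
    last first.
    by rewrite !mul0r mulr0.
  have := beta_cocycle w g x y r2; rewrite -conjgM => E.
  case: (_ == g) (_ == (_ * _)%g) (r1 == _) => [] [] [];
    by rewrite ?mul0r ?mulr0 ?mul1r // -E.
rewrite /=; have [E1|_] := eqVneq q1 (g ^ x)%g; last by rewrite !andbF !mul0r.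
have [E2|_] := eqVneq q2 (y * r2)%g; last by rewrite /= !andbF mul0r mulr0.
by rewrite E1 E2 eqxx in ne.
Qed.

Fact reg_act1 : \sum_g reg_act g 1%g = 1%:M.
Proof.
apply/matrixP=> i j; rewrite summxE mxE -(inj_eq enum_val_inj).
under eq_bigr do rewrite mxE betag1l mulr1 mul1g conjg1.
move: (enum_val i) (enum_val j) => [p1 p2] [r1 r2] /=.
rewrite (bigD1 p1) //= big1 ?addr0 => [|g ne]; last first.
  by rewrite eq_sym (negPf ne).
by rewrite eqxx xpair_eqE /= andbC [r1 == _]eq_sym.
Qed.

Definition regular : dmod := DMod reg_actM reg_act1.

Lemma regularE g x p r :
  dact regular g x (enum_rank p) (enum_rank r) =
  [&& p.1 == g, p.2 == (x * r.2)%g & r.1 == (g ^ x)%g]%:R * beta g x r.2.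
Proof. by rewrite mxE !enum_rankK. Qed.

End RegularModule.

(** * The equivariant idempotent attached to a triple *)

Section TripleIdempotent.
Variables (gT : finGroupType) (k : fieldType) (w : cocycle3 gT k).
Hypothesis char0 : [pchar k] =i pred0.
Local Notation beta := (beta w).
Local Notation dmod := (dmod w).
Variables (t : triple w) (M : dmod).
Local Notation K := (tK t).
Local Notation H := (tH t).
Local Notation B := (tB t).

(** After division by [B g], the group [H] acts honestly on the degree [g] part; this is its
    averaging projector there, and it is zero in degrees outside [K]. *)
Definition tidem : 'M[k]_(ddim M) :=
  \sum_(g in K) #|H|%:R^-1 *: \sum_(h in H) (B g h)^-1 *: dact M g h.

Let H0 : #|H|%:R != 0 :> k. Proof. by rewrite natr_neq0. Qed.

Lemma tidem_mul g x : g \in K -> tidem *m dact M g x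
  = #|H|%:R^-1 *: \sum_(h in H) (beta g h x / B g h) *: dact M g (h * x)%g.
Proof.
move=> gK; rewrite mulmx_suml (bigD1 g) //= [X in _ + X]big1 ?addr0.
  rewrite -scalemxAl mulmx_suml; congr (_ *: _); apply: eq_bigr => h hH.
  have := dact_mulE M g h x; rewrite (tKH_conjl gK hH) => E.
  by rewrite -scalemxAl E scalerA mulrC.
move=> g' /andP[g'K ne]; rewrite -scalemxAl mulmx_suml big1 ?scaler0 // => h hH.
by rewrite -scalemxAl dactM (tKH_conjl g'K hH) eq_sym (negPf ne) scaler0.
Qed.

Lemma tidem_out g x : g \notin K -> tidem *m dact M g x = 0.
Proof.
move=> gK; rewrite mulmx_suml big1 // => g' g'K.
rewrite -scalemxAl mulmx_suml big1 ?scaler0 // => h hH.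
rewrite -scalemxAl dactM (tKH_conjl g'K hH).
by case: eqP => [E|_]; [rewrite E g'K in gK | rewrite scaler0].
Qed.

Lemma tidem_hom : dhom (N := M) tidem.
Proof.
move=> g x; have [gK|gK] := boolP (g \in K); last first.
  rewrite tidem_out // mulmx_sumr big1 // => g' g'K.
  rewrite -scalemxAr mulmx_sumr big1 ?scaler0 // => h hH.
  rewrite -scalemxAr dactM; case: eqP => [E|_]; last by rewrite scaler0.
  by rewrite E tK_conj (negPf gK) in g'K.
rewrite tidem_mul // mulmx_sumr [RHS](bigD1 (g ^ x)%g) ?tK_conj //=.
rewrite [X in _ + X]big1 ?addr0 => [|g' /andP[_ ne]]; last first.
  rewrite -scalemxAr mulmx_sumr big1 ?scaler0 // => h hH.
  by rewrite -scalemxAr dactM (negPf ne) scaler0.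
rewrite -scalemxAr mulmx_sumr; congr (_ *: _).
(* Moving [x] across the sum conjugates [h]; [tB_conj] says that the coefficients agree after this
   change of variable. *)
rewrite [RHS](reindex_inj (conjg_inj x)) /=.
apply: eq_big => [h|h hH]; first by rewrite tH_conj.
rewrite -scalemxAr dact_mulE scalerA -conjgC; congr (_ *: _).
have b1 := beta_neq0 w g h x; have b2 := beta_neq0 w g x (h ^ x)%g.
have b3 : B (g ^ x)%g (h ^ x)%g != 0 by rewrite tB_neq0 ?tK_conj ?tH_conj.
by rewrite (tB_conj x gK hH); field; rewrite b1 b2 b3.
Qed.

Lemma tidem_scalar g h : h \in H ->
  tidem *m dact M g h = B g h *: (tidem *m dact M g 1%g).
Proof.
move=> hH; have [gK|gK] := boolP (g \in K); last by rewrite !tidem_out ?scaler0.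
rewrite !tidem_mul // [RHS]scalerA [B _ _ * _]mulrC -[RHS]scalerA; congr (_ *: _).
rewrite [in RHS](reindex_inj (mulIg h)) scaler_sumr /=.
apply: eq_big => [x|x xH]; first by rewrite groupMr.
rewrite scalerA mulg1 betag1; congr (_ *: _).
have [-> //  _] := tB_bichar t.
have b1 := beta_neq0 w g x h; have b2 := tB_neq0 gK hH; have b3 := tB_neq0 gK xH.
by field; rewrite b1 b2 b3.
Qed.

Lemma tidem_idem : tidem *m tidem = tidem.
Proof.
rewrite -[RHS]mulmx1 -dact1 [RHS]mulmx_sumr [RHS](bigID [in K]) /=.
rewrite [X in _ + X]big1 ?addr0 => [|g gK]; last exact: tidem_out.
rewrite {2}/tidem mulmx_sumr; apply: eq_bigr => g gK.
rewrite -scalemxAr mulmx_sumr (eq_bigr (fun=> tidem *m dact M g 1%g)).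
  by rewrite sumr_const -scaler_nat scalerA mulVf // scale1r.
move=> h hH; rewrite -scalemxAr (tidem_scalar g hH) scalerA mulVf ?scale1r //.
exact: tB_neq0.
Qed.

End TripleIdempotent.

(** The witness is the image of [tidem] in the regular module, where distinct basis elements act by
    matrices with distinct nonzero positions. *)
Lemma triple_module (gT : finGroupType) (k : fieldType) (w : cocycle3 gT k)
    (t : triple w) : [pchar k] =i pred0 ->
  exists N : dmod w, [/\ tsub t N, forall a, a \in tK t -> dact N a 1%g != 0
    & forall h, dact N 1%g h = dact N 1%g 1%g -> h \in tH t].
Proof.
move=> char0; pose M := regular w; pose e := tidem t M.
have H0 : #|tH t|%:R^-1 != 0 :> k by rewrite invr_eq0 natr_neq0.
have [N [p [i [hp hi pi ip _]]]] := idem_split (@tidem_hom _ _ _ t M)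
  (tidem_idem char0 t M).
have NE g x : dact N g x = p *m (e *m dact M g x) *m i.
  by rewrite /e -ip !mulmxA pi mul1mx hp -mulmxA pi mulmx1.
have eE g x : e *m dact M g x = i *m dact N g x *m p.
  by rewrite NE -!mulmxA !(mulmxA i p) ip -(@tidem_hom _ _ _ t M) !mulmxA
    !tidem_idem.
exists N; split=> [g h hH|a aK|h Nh].
- by rewrite !NE tidem_scalar // -scalemxAr -scalemxAl.
- apply/eqP => Na; have := eE a 1%g; rewrite Na mulmx0 mul0mx tidem_mul //.
  move=> /eqP; rewrite scaler_eq0 (negPf H0) => /eqP/matrixP.
  (* At this diagonal entry only the term [h = 1] of the idempotent contributes, with value 1. *)
  move=> /(_ (enum_rank (a, 1%g)) (enum_rank (a, 1%g))); rewrite summxE mxE.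
  rewrite (bigD1 1%g) ?group1 //= big1 ?addr0 => [|x /andP[xH x1]].
    rewrite mxE regularE /= !mulg1 conjg1 !eqxx !betag1 tB_g1 //.
    by rewrite invr1 !mul1r => /eqP; rewrite oner_eq0.
  by rewrite mxE regularE /= !mulg1 [1%g == x]eq_sym (negPf x1) andbF mul0r mulr0.
have : e *m dact M 1%g h = e *m dact M 1%g 1%g by rewrite !eE Nh.
rewrite !tidem_mul // => /(scalerI H0)/matrixP.
(* Here the left side is 1, while the right side can be nonzero only through a term [x = h] with [x]
   in [H]. *)
move=> /(_ (enum_rank (1%g, h)) (enum_rank (1%g, 1%g))); rewrite !summxE.
rewrite (bigD1 1%g) ?group1 //= big1 ?addr0 => [|x /andP[xH x1]]; last first.
  rewrite mxE regularE /= mulg1 -[h == _](inj_eq (mulIg h^-1%g)) mulgV mulgK.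
  by rewrite [1%g == x]eq_sym (negPf x1) andbF mul0r mulr0.
rewrite mxE regularE /= mul1g mulg1 conj1g !eqxx !beta1g tB_1h // invr1 !mulr1 => E.
apply: contrapT => /negP hH; move/eqP: E; rewrite big1 ?oner_eq0 // => x xH.
rewrite mxE regularE /= !mulg1; case: (h =P x) => [hx|_];
  last by rewrite andbF mul0r mulr0.
by rewrite hx xH in hH.
Qed.

(** * Recovering the triple and proving the bijection *)

Section Correspondence.
Variables (gT : finGroupType) (k : fieldType) (w : cocycle3 gT k).
Hypothesis char0 : [pchar k] =i pred0.
Variable t : triple w.

Lemma supp_tsubcat : tK t = supp_group (tsubcat t).
Proof.
have [N [tN NK _]] := triple_module t char0.
apply/val_inj/setP => g /=; apply/idP/suppP => [gK|[M tM Mg]].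
  by exists N => //; apply: NK.
by apply: contraNT Mg => gK; rewrite (tsub_out _ tM gK).
Qed.

Lemma ker_tsubcat : tH t = ker_group (tsubcat t).
Proof.
have [N [tN _ NH]] := triple_module t char0.
apply/val_inj/setP => h /=; apply/idP/kerP => [hH M tM|hK].
  by rewrite tM // tB_1h // scale1r.
by apply: NH; apply: hK.
Qed.

End Correspondence.

Lemma fusion_subcat_ext (gT : finGroupType) (k : fieldType) (w : cocycle3 gT k)
    (D D' : fusion_subcat w) : (forall M, D M <-> D' M) -> D = D'.
Proof.
case: D D' => P a b c d e f [P' a' b' c' d' e' f'] /= E.
have {E}EP : P = P' by apply/funext => M; apply/propext.
by subst P'; congr FusionSubcat; apply: Prop_irrelevance.
Qed.

Theorem theorem5p11 (gT : finGroupType) (k : closedFieldType)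
  (char0 : [pchar k] =i pred0) (w : cocycle3 gT k) (R : {set gT})
  (hR : is_transversal R (classes [set: gT]) [set: gT]) :
  exists (toTriple : fusion_subcat w -> triple w)
         (toSubcat : triple w -> fusion_subcat w),
    [/\ forall D : fusion_subcat w, triple_of R D (toTriple D),
        forall (t : triple w) (M : dmod w),
          toSubcat t M <-> subcat_S R (tK t) (tH t) (tB t) M,
        cancel toTriple toSubcat
      & cancel toSubcat toTriple].
Proof.
(* The triple of [D] also describes membership in [D], so once it is chosen the first cancellation
   is only extensionality. *)
have spec (D : fusion_subcat w) : exists t : triple w,
    triple_of R D t /\ forall M, D M <-> tsub t M.
  have [t [tKE tHE tD]] := subcat_triple D; exists t; split.
    exact: (triple_of_tsub char0 hR).
  by move=> M; split; [exact: tD | exact: (tsub_fobj char0)].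
have /choice[toTriple toTripleP] := spec.
exists toTriple, (@tsubcat gT k w); split=> [D|t M|D|t].
- by have [] := toTripleP D.
- exact: (subcat_SE char0).
- by apply: fusion_subcat_ext => M; have [_ ->] := toTripleP D.
(* Both triples satisfy the specification for [tsubcat t], which has at most one solution; for [t]
   itself this rests on the module built from the regular one. *)
- apply: (triple_of_inj (R := R) (D := tsubcat t));
    first by have [] := toTripleP (tsubcat t).
  apply: (triple_of_tsub char0 hR) => //; first exact: supp_tsubcat.
  exact: ker_tsubcat.
Qed.
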